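(* Let $A$ be a self-adjoint and locally compact operator on $L^2(\mathbb{R}^d)$ with domain $D(A)$. Suppose that, for some $\phi\in C_0^\infty(\mathbb{R}^d)$ with $\operatorname{supp}\phi\subset B(0,2)$, $\phi\ge 0$ and $\phi=1$ on $B(0,1)$, the functions $\phi_k(x)=\phi(x/k)$, $k\in\mathbb{N}$, $k\ge1$, satisfy $$\left\| [A,\phi_k]\,(A-i)^{-1}\right\|\to 0\quad\text{as }k\to\infty .$$ Then $\sigma_{ess}(A)=Z(A)$, where $Z(A)$ is the Zhislin spectrum of $A$.
   Context: $B(x,R)$ is the ball of radius $R$ centred at $x$. Functions act as multiplication operators, and $[A,\phi_k]=A\phi_k-\phi_kA$; the commutator hypothesis is understood to include that multiplication by $\phi_k$ maps $D(A)$ into $D(A)$, so that $[A,\phi_k](A-i)^{-1}$ is defined on $L^2(\mathbb{R}^d)$. Locally compact: a closed operator $A$ on $L^2(\mathbb{R}^d)$ with nonempty resolvent set $\rho(A)$ is locally compact if for each bounded (measurable) set $B\subset\mathbb{R}^d$, with characteristic function $\chi_B$, the operator $\chi_B(A-\lambda)^{-1}$ is compact for some (and hence all) $\lambda\in\rho(A)$. Zhislin sequence: let $B_k=\{x\in\mathbb{R}^d:\|x\|\le k\}$. A sequence $(u_k)_k$ is a Zhislin sequence for a closed operator $A$ and $\lambda\in\mathbb{C}$ if $u_k\in D(A)$, $\|u_k\|=1$, $\operatorname{supp}u_k\subset\mathbb{R}^d\setminus B_k$, and $\|(A-\lambda)u_k\|\to0$ as $k\to\infty$. The Zhislin spectrum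 $Z(A)$ is the set of all $\lambda\in\mathbb{C}$ for which there exists a Zhislin sequence for $A$ and $\lambda$. The discrete spectrum $\sigma_{disc}(A)$ is the set of eigenvalues of finite multiplicity that are isolated points of $\sigma(A)$, and $\sigma_{ess}(A)=\sigma(A)\setminus\sigma_{disc}(A)$. *)

(* Defs.v *)
From HB Require Import structures.
From mathcomp Require Import all_boot all_order all_algebra sesquilinear.
From mathcomp Require Import complex.
From mathcomp Require Import all_classical all_reals all_analysis.
Import Order.TTheory GRing.Theory Num.Theory.
Import numFieldNormedType.Exports.

Set Implicit Arguments.
Unset Strict Implicit.
Unset Printing Implicit Defensive.

Local Open Scope classical_set_scope.
Local Open Scope ring_scope.
Local Open Scope quotient_scope.

(* The sigma-algebra generated by the coordinates, i.e. the Borel one. *)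
Section measurable_rV.
Context {R : realType} {n : nat}.

Let coor : 'I_n -> 'rV[R]_n -> measurableTypeR R := fun i x => x ord0 i.

Let rV_set0 : g_sigma_preimage coor set0.
Proof. exact: sigma_algebra0. Qed.

Let rV_setC A : g_sigma_preimage coor A -> g_sigma_preimage coor (~` A).
Proof. exact: sigma_algebraC. Qed.

Let rV_bigcup (F : _^nat) : (forall i, g_sigma_preimage coor (F i)) ->
  g_sigma_preimage coor (\bigcup_i (F i)).
Proof. exact: sigma_algebra_bigcup. Qed.

HB.instance Definition _ := @isMeasurable.Build default_measure_display
  'rV[R]_n (g_sigma_preimage coor) rV_set0 rV_setC rV_bigcup.

End measurable_rV.

Section rV_measurable_maps.
Context {R : realType}.

Lemma measurable_rV_coord n (i : 'I_n) :
  measurable_fun setT (fun x : 'rV[R]_n => x ord0 i : measurableTypeR R).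
Proof.
case: n i => [[]//|n] i _ B mB; rewrite setTI; apply: sub_sigma_algebra.
rewrite -bigcup_mkord_ord; exists i => //=; exists B => //.
by rewrite setTI inord_val.
Qed.

Lemma measurable_rVP d (T : measurableType d) n (f : T -> 'rV[R]_n) :
  (forall i, measurable_fun setT (fun x => f x ord0 i : measurableTypeR R)) ->
  measurable_fun setT f.
Proof.
case: n f => [|n] f mf; apply: (measurability
  (\big[setU/set0]_(i < _) preimage_set_system setT
     (fun x : 'rV[R]_ _ => x ord0 i : measurableTypeR R) measurable)) => //.
  by move=> _ [B + <-]; rewrite big_ord0.
move=> _ [B + <-]; rewrite -bigcup_mkord_ord => -[i _ [C mC <-]].
by rewrite setTI; exact: mf.
Qed.

Definition rV_cons n (p : measurableTypeR R * 'rV[R]_n) : 'rV[R]_n.+1 :=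
  row_mx (p.1)%:M p.2.

Definition rV_uncons n (x : 'rV[R]_n.+1) : measurableTypeR R * 'rV[R]_n :=
  (x ord0 ord0, \row_i x ord0 (lift ord0 i)).

Lemma rV_cons0 n (p : measurableTypeR R * 'rV[R]_n) :
  rV_cons p ord0 ord0 = p.1.
Proof.
have -> : ord0 = lshift n (ord0 : 'I_1) by apply/val_inj.
by rewrite /rV_cons (@row_mxEl _ 1 1 n) mxE eqxx mulr1n.
Qed.

Lemma rV_cons_lift n (p : measurableTypeR R * 'rV[R]_n) i :
  rV_cons p ord0 (lift ord0 i) = p.2 ord0 i.
Proof.
have -> : lift ord0 i = rshift 1 i by apply/val_inj.
by rewrite /rV_cons (@row_mxEr _ 1 1 n).
Qed.

Lemma rV_consK n : cancel (@rV_cons n) (@rV_uncons n).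
Proof.
move=> [a v]; rewrite /rV_uncons rV_cons0; congr pair.
by apply/rowP => i; rewrite mxE rV_cons_lift.
Qed.

Lemma measurable_rV_cons n : measurable_fun setT (@rV_cons n).
Proof.
apply: measurable_rVP => i; case: (unliftP ord0 i) => [j|] ->.
- rewrite [X in measurable_fun _ X](_ : _ =
    (fun x : 'rV[R]_n => x ord0 j : measurableTypeR R) \o snd).
    exact: (measurableT_comp (measurable_rV_coord j) measurable_snd).
  by apply/funext => p; rewrite rV_cons_lift.
- rewrite [X in measurable_fun _ X](_ : _ = fst); first exact: measurable_fst.
  by apply/funext => p; rewrite rV_cons0.
Qed.

Lemma measurable_rV_uncons n : measurable_fun setT (@rV_uncons n).
Proof.
apply: measurable_fun_pair; first exact: measurable_rV_coord.
apply: measurable_rVP => i.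
rewrite [X in measurable_fun _ X](_ : _ =
    (fun x : 'rV[R]_n.+1 => x ord0 (lift ord0 i) : measurableTypeR R)).
  exact: measurable_rV_coord.
by apply/funext => x; rewrite mxE.
Qed.

End rV_measurable_maps.

(* The library instance for [m1 \x m2] is hidden by the one for subprobability
   measures, which has the same key. *)
Lemma sigma_finite_prod d1 d2 (T1 : measurableType d1)
    (T2 : measurableType d2) (R : realType)
    (m1 : {sigma_finite_measure set T1 -> \bar R})
    (m2 : {sigma_finite_measure set T2 -> \bar R}) :
  sigma_finite setT (m1 \x m2)%E.
Proof.
have /sigma_finiteP[F [TF ndF Foo]] := sigma_finiteT m1.
have /sigma_finiteP[G [TG ndG Goo]] := sigma_finiteT m2.
exists (fun n => F n `*` G n).
  rewrite -setXTT TF TG predeqE => -[x y]; split.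
    move=> [/= [n _ Fnx] [k _ Gky]]; exists (maxn n k) => //; split.
    - by move: x Fnx; exact/subsetPset/ndF/leq_maxl.
    - by move: y Gky; exact/subsetPset/ndG/leq_maxr.
  by move=> [n _ []/= ? ?]; split; exists n.
move=> k; have [? ?] := Foo k; have [? ?] := Goo k.
split; first exact: measurableX.
by rewrite product_measure1E// lte_mul_pinfty// ge0_fin_numE.
Qed.

Section lebesgue_rV_step.
Context {R : realType} {n : nat}.
Variable mu : {sigma_finite_measure set 'rV[R]_n -> \bar R}.

Definition lebesgue_rV_cons : set 'rV[R]_n.+1 -> \bar R :=
  pushforward (@lebesgue_measure R \x mu)%E (@rV_cons R n).

Let mcons := measurable_rV_cons (R := R) (n := n).

Let lebesgue_rV_cons0 : lebesgue_rV_cons set0 = 0%E.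
Proof. exact: (measure0 (measure_function_pushforward__canonical__measure_function_Measure _ mcons)). Qed.

Let lebesgue_rV_cons_ge0 A : (0 <= lebesgue_rV_cons A)%E.
Proof. exact: (measure_ge0 (measure_function_pushforward__canonical__measure_function_Measure _ mcons)). Qed.

Let lebesgue_rV_cons_sigma_additive : semi_sigma_additive lebesgue_rV_cons.
Proof.
exact: (@measure_semi_sigma_additive _ _ _
  (measure_function_pushforward__canonical__measure_function_Measure
    (@lebesgue_measure R \x mu)%E mcons)).
Qed.

HB.instance Definition _ := isMeasure.Build _ _ _ lebesgue_rV_cons
  lebesgue_rV_cons0 lebesgue_rV_cons_ge0 lebesgue_rV_cons_sigma_additive.

Let lebesgue_rV_cons_sigma_finite : sigma_finite setT lebesgue_rV_cons.
Proof.
have [F TF Foo] : sigma_finite setT (@lebesgue_measure R \x mu)%E.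
  exact: sigma_finite_prod.
exists (fun k => @rV_uncons R n @^-1` F k).
  by rewrite -preimage_bigcup -TF preimage_setT.
move=> k; have [mF Fk] := Foo k; split.
  by rewrite -[X in measurable X]setTI; exact: measurable_rV_uncons.
rewrite /lebesgue_rV_cons /pushforward -comp_preimage.
by rewrite (_ : _ \o _ = id)//; apply/funext; exact: rV_consK.
Qed.

HB.instance Definition _ := Measure_isSigmaFinite.Build _ _ _
  lebesgue_rV_cons lebesgue_rV_cons_sigma_finite.

End lebesgue_rV_step.

Fixpoint lebesgue_rV {R : realType} (n : nat) :
    {sigma_finite_measure set 'rV[R]_n -> \bar R} :=
  if n is m.+1 then lebesgue_rV_cons (lebesgue_rV m)
  else \d_(0 : 'rV[R]_0).

Lemma lebesgue_rV_box {R : realType} n (A : 'I_n -> set (measurableTypeR R)) :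
  (forall i, measurable (A i)) ->
  (lebesgue_rV n [set x : 'rV[R]_n | forall i, A i (x ord0 i)] =
   \prod_(i < n) lebesgue_measure (A i))%E.
Proof.
elim: n A => [|n ih] A mA.
  rewrite big_ord0 /= /dirac /= (_ : [set x | _] = setT) ?indicT//.
  by apply/seteqP; split => // x _ [].
rewrite big_ord_recl/= -ih// -product_measure1E//; last first.
  rewrite (_ : [set x | _] = \bigcap_(i in [set: 'I_n])
      (fun x : 'rV[R]_n => x ord0 i : measurableTypeR R) @^-1` A (lift ord0 i)).
    apply: fin_bigcap_measurable => [|i _]; first exact: finite_finset.
    by rewrite -[X in measurable X]setTI; exact: measurable_rV_coord.
  by apply/seteqP; split => x /= h i => [_|]; exact: h.
congr product_measure1; apply/seteqP; split => [p|p [A0 Ai] i] /=.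
  move=> h; split; first by rewrite -rV_cons0; exact: h.
  by move=> i; rewrite -rV_cons_lift; exact: h.
by case: (unliftP ord0 i) => [j|] ->; rewrite ?rV_cons_lift ?rV_cons0.
Qed.

(* Cauchy-Schwarz and the triangle inequality of sesquilinear.v, which are
   restricted to finite dimensional spaces *)
Section dot_lmodType.
Variables (C : numClosedFieldType) (U : lmodType C).
Variable form : {dot U for Num.conj}.

Lemma dot_CauchySchwarz u v :
  `|form u v| ^+ 2 <= form u u * form v v.
Proof.
have [->|v0] := eqVneq v 0.
  by rewrite !linear0r normr0 expr0n.
pose a := form u v / form v v; pose w := u - a *: v.
have vn0 : form v v != 0 by rewrite dnorm_eq0.
have wv : form w v = 0 by rewrite linearBl/= linearZl_LR/= divfK ?subrr.
have uE : form u u = form w w + `|a| ^+ 2 * form v v.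
  have {1 2}-> : u = w + a *: v by rewrite subrK.
  by rewrite hnormDd/= ?dnormZ// linearZr_LR/= wv mulr0.
rewrite uE mulrDl -mulrA -expr2.
have -> : `|form u v| ^+ 2 = `|a| ^+ 2 * form v v ^+ 2.
  rewrite -[form v v in RHS]ger0_norm ?dnorm_ge0// -exprMn -normrM.
  by rewrite divfK.
by rewrite lerDr mulr_ge0// dnorm_ge0.
Qed.

Lemma dot_triangle u v :
  sqrtC (form (u + v) (u + v)) <= sqrtC (form u u) + sqrtC (form v v).
Proof.
rewrite -ler_sqr ?nnegrE ?addr_ge0 ?sqrtC_ge0 ?dnorm_ge0//.
rewrite sqrrD !sqrtCK dnormD /= [leRHS]addrAC lerD2l.
have -> : form u v + (form u v)^* = 'Re (form u v) *+ 2.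
  by rewrite ReE -mulr_natr divfK// pnatr_eq0.
rewrite lerMn2r/=; apply: (le_trans (leif_Re_Creal _)).
rewrite -ler_sqr ?nnegrE ?mulr_ge0 ?sqrtC_ge0 ?dnorm_ge0//.
by rewrite exprMn !sqrtCK dot_CauchySchwarz.
Qed.

End dot_lmodType.

Section complex_L2.
Context d (T : measurableType d) (R : realType).
Variable mu : {measure set T -> \bar R}.
Implicit Types f g : T -> R[i].

(* [f] is measurable and [|f|^2 = Re f ^ 2 + Im f ^ 2] has a finite integral *)
Definition cLfun2 : {pred T -> R[i]} := fun f =>
  ((fun x => complex.Re (f x)) \in Lfun mu 2%:E) &&
  ((fun x => complex.Im (f x)) \in Lfun mu 2%:E).

Let two1 : (1 <= 2%:E :> \bar R)%E. Proof. by rewrite lee_fin ler1n. Qed.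

Let Lfun2D (f g : T -> R) : f \in Lfun mu 2%:E -> g \in Lfun mu 2%:E ->
  (fun x => f x + g x) \in Lfun mu 2%:E.
Proof. exact: (Lfun_addr_closed mu two1).2. Qed.

Let Lfun2_0 : (fun=> 0 : R) \in Lfun mu 2%:E.
Proof. exact: (Lfun_addr_closed mu two1).1. Qed.

Let Lfun2Z (a : R) (f : T -> R) : f \in Lfun mu 2%:E ->
  (fun x => a * f x) \in Lfun mu 2%:E.
Proof.
move=> lf; rewrite (_ : (fun x => _) = (fun x => a * f x + 0)).
  exact: (Lfun_submod_closed mu two1).2.
by apply/funext => x; rewrite addr0.
Qed.

Lemma cLfun2_0 : (fun=> 0) \in cLfun2.
Proof. by apply/andP. Qed.

Lemma cLfun2D f g : f \in cLfun2 -> g \in cLfun2 ->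
  (fun x => f x + g x) \in cLfun2.
Proof.
move=> /andP[rf i_f] /andP[rg ig]; apply/andP; split.
  rewrite (_ : (fun x => _) = fun x => complex.Re (f x) + complex.Re (g x)).
    exact: Lfun2D.
  by apply/funext => x; case: (f x) (g x) => [? ?] [? ?].
rewrite (_ : (fun x => _) = fun x => complex.Im (f x) + complex.Im (g x)).
  exact: Lfun2D.
by apply/funext => x; case: (f x) (g x) => [? ?] [? ?].
Qed.

Lemma cLfun2Z (a : R[i]) f : f \in cLfun2 -> (fun x => a * f x) \in cLfun2.
Proof.
case: a => a b /andP[rf i_f]; apply/andP; split.
  rewrite (_ : (fun x => _) =
      fun x => a * complex.Re (f x) + (- b) * complex.Im (f x)).
    by apply: Lfun2D; exact: Lfun2Z.
  by apply/funext => x; case: (f x) => [? ?] /=; rewrite mulNr.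
rewrite (_ : (fun x => _) =
    fun x => a * complex.Im (f x) + b * complex.Re (f x)).
  by apply: Lfun2D; exact: Lfun2Z.
by apply/funext => x; case: (f x).
Qed.

Definition cLfun2_type := {f : T -> R[i] | f \in cLfun2}.

Definition cLfun2_ae_eq (f g : cLfun2_type) : bool :=
  `[< \forall x \ae mu, val f x = val g x >].

Let cLfun2_ae_eq_refl : reflexive cLfun2_ae_eq.
Proof. by move=> f; apply/asboolP; near=> x. Unshelve. all: by end_near. Qed.

Let cLfun2_ae_eq_sym : symmetric cLfun2_ae_eq.
Proof. by move=> f g; apply/asbool_equiv_eq; split; apply: filterS. Qed.

Let cLfun2_ae_eq_trans : transitive cLfun2_ae_eq.
Proof.
move=> f g h /asboolP gf /asboolP fh; apply/asboolP.
by apply: filterS2 gf fh => x -> ->.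
Qed.

Canonical cLfun2_ae_eq_canonical := EquivRel cLfun2_ae_eq
  cLfun2_ae_eq_refl cLfun2_ae_eq_sym cLfun2_ae_eq_trans.

Definition L2 : Type := {eq_quot cLfun2_ae_eq}.
HB.instance Definition _ := Choice.on L2.
HB.instance Definition _ := EqQuotient.on L2.

Definition L2_fun (u : L2) : T -> R[i] := val (repr u).
Coercion L2_fun : L2 >-> Funclass.

(* the class of [f], with value [0] if [f] is not square integrable *)
Definition L2_of f : L2 :=
  \pi_L2 (insubd (exist (fun f => f \in cLfun2) (fun=> 0) cLfun2_0) f).

Implicit Types u v w : L2.

Lemma L2_funP u : (u : T -> R[i]) \in cLfun2.
Proof. exact: valP. Qed.

Lemma L2_ofE f : f \in cLfun2 -> \forall x \ae mu, L2_of f x = f x.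
Proof.
move=> lf; suff /asboolP : cLfun2_ae_eq (repr (L2_of f))
    (insubd (exist (fun f => f \in cLfun2) (fun=> 0) cLfun2_0) f).
  by rewrite insubdK.
by apply/eqmodP; rewrite reprK.
Qed.

Lemma L2P u v : (\forall x \ae mu, u x = v x) -> u = v.
Proof. by move=> uv; rewrite -[u]reprK -[v]reprK; apply/eqmodP/asboolP. Qed.

Definition L2_add u v := L2_of (fun x => u x + v x).
Definition L2_opp u := L2_of (fun x => - u x).
Definition L2_scale a u := L2_of (fun x => a * u x).

Let L2_addE u v : \forall x \ae mu, L2_add u v x = u x + v x.
Proof. by apply: L2_ofE; apply: cLfun2D; exact: L2_funP. Qed.

Let L2_scaleE a u : \forall x \ae mu, L2_scale a u x = a * u x.
Proof. by apply: L2_ofE; apply: cLfun2Z; exact: L2_funP. Qed.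

Let L2_oppE u : \forall x \ae mu, L2_opp u x = - u x.
Proof.
apply: L2_ofE; rewrite (_ : (fun x => _) = fun x => -1 * u x).
  by apply: cLfun2Z; exact: L2_funP.
by apply/funext => x; rewrite mulN1r.
Qed.

Let L2_0E : \forall x \ae mu, L2_of (fun=> 0) x = 0.
Proof. exact: L2_ofE cLfun2_0. Qed.

Let L2_addA : associative L2_add.
Proof.
move=> u v w; apply: L2P; near=> x.
rewrite (near (L2_addE u (L2_add v w)) x)// (near (L2_addE v w) x)//.
by rewrite (near (L2_addE (L2_add u v) w) x)// (near (L2_addE u v) x)// addrA.
Unshelve. all: by end_near. Qed.

Let L2_addC : commutative L2_add.
Proof.
move=> u v; apply: L2P; near=> x.
by rewrite (near (L2_addE u v) x)// (near (L2_addE v u) x)// addrC.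
Unshelve. all: by end_near. Qed.

Let L2_add0 : left_id (L2_of (fun=> 0)) L2_add.
Proof.
move=> u; apply: L2P; near=> x.
by rewrite (near (L2_addE (L2_of (fun=> 0)) u) x)// (near L2_0E x)// add0r.
Unshelve. all: by end_near. Qed.

Let L2_addN : left_inverse (L2_of (fun=> 0)) L2_opp L2_add.
Proof.
move=> u; apply: L2P; near=> x.
rewrite (near (L2_addE (L2_opp u) u) x)// (near L2_0E x)//.
by rewrite (near (L2_oppE u) x)// addNr.
Unshelve. all: by end_near. Qed.

HB.instance Definition _ :=
  GRing.isZmodule.Build L2 L2_addA L2_addC L2_add0 L2_addN.

Let L2_scaleA a b u : L2_scale a (L2_scale b u) = L2_scale (a * b) u.
Proof.
apply: L2P; near=> x.
rewrite (near (L2_scaleE a (L2_scale b u)) x)// (near (L2_scaleE b u) x)//.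
by rewrite (near (L2_scaleE (a * b) u) x)// mulrA.
Unshelve. all: by end_near. Qed.

Let L2_scale1 : left_id 1 L2_scale.
Proof.
move=> u; apply: L2P; near=> x.
by rewrite (near (L2_scaleE 1 u) x)// mul1r.
Unshelve. all: by end_near. Qed.

Let L2_scaleDr : right_distributive L2_scale +%R.
Proof.
move=> a u v; apply: L2P; near=> x.
rewrite (near (L2_scaleE a (u + v)) x)// (near (L2_addE u v) x)//.
rewrite (near (L2_addE (L2_scale a u) (L2_scale a v)) x)//.
by rewrite (near (L2_scaleE a u) x)// (near (L2_scaleE a v) x)// mulrDr.
Unshelve. all: by end_near. Qed.

Let L2_scaleDl u : {morph L2_scale^~ u : a b / a + b}.
Proof.
move=> a b; apply: L2P; near=> x.
rewrite (near (L2_scaleE (a + b) u) x)//.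
rewrite (near (L2_addE (L2_scale a u) (L2_scale b u)) x)//.
by rewrite (near (L2_scaleE a u) x)// (near (L2_scaleE b u) x)// mulrDl.
Unshelve. all: by end_near. Qed.

HB.instance Definition _ := GRing.Zmodule_isLmodule.Build R[i] L2
  L2_scaleA L2_scale1 L2_scaleDr L2_scaleDl.

Lemma L2_funD u v : \forall x \ae mu, (u + v : L2) x = u x + v x.
Proof. exact: L2_addE. Qed.

Lemma L2_funZ a u : \forall x \ae mu, (a *: u : L2) x = a * u x.
Proof. exact: L2_scaleE. Qed.

Lemma L2_fun0 : \forall x \ae mu, (0 : L2) x = 0.
Proof. exact: L2_0E. Qed.

Definition cintegrable f :=
  mu.-integrable setT (EFin \o (fun x => complex.Re (f x))) /\
  mu.-integrable setT (EFin \o (fun x => complex.Im (f x))).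

Definition cintegral f : R[i] :=
  Complex (\int[mu]_x complex.Re (f x)) (\int[mu]_x complex.Im (f x)).

Definition L2_dot u v : R[i] := cintegral (fun x => u x * (v x)^*).

Let eqint (f g : T -> \bar R) : mu.-integrable setT f ->
  (forall x, f x = g x) -> mu.-integrable setT g.
Proof. by move=> + fg; rewrite (_ : f = g)//; exact/funext. Qed.

Let integrableM2 (f g : T -> R) : f \in Lfun mu 2%:E -> g \in Lfun mu 2%:E ->
  mu.-integrable setT (EFin \o (fun x => f x * g x)).
Proof. by move=> lf lg; exact/Lfun1_integrable/Lfun2_mul_Lfun1. Qed.

Lemma cintegrable_dot f g : f \in cLfun2 -> g \in cLfun2 ->
  cintegrable (fun x => f x * (g x)^*).
Proof.
move=> /andP[rf i_f] /andP[rg ig]; split.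
  apply: (eqint
    (integrableD _ (integrableM2 rf rg) (integrableM2 i_f ig))) => // x /=.
  by rewrite -EFinD; case: (f x) (g x) => [? ?] [? ?] /=; rewrite mulrN opprK.
apply: (eqint
  (integrableB _ (integrableM2 i_f rg) (integrableM2 rf ig))) => // x /=.
rewrite -EFinB; case: (f x) (g x) => [? ?] [? ?] /=.
by rewrite mulrN addrC mulrC.
Qed.

Lemma eq_ae_cintegral f g : cintegrable f -> cintegrable g ->
  (\forall x \ae mu, f x = g x) -> cintegral f = cintegral g.
Proof.
move=> [rf i_f] [rg ig] fg; rewrite /cintegral /Rintegral; congr Complex.
  congr fine; apply: ae_eq_integral => //.
  - exact: measurable_int rf.
  - exact: measurable_int rg.
  - by apply: filterS fg => x /= -> _.
congr fine; apply: ae_eq_integral => //.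
- exact: measurable_int i_f.
- exact: measurable_int ig.
- by apply: filterS fg => x /= -> _.
Qed.

Lemma cintegrableD f g : cintegrable f -> cintegrable g ->
  cintegrable (fun x => f x + g x).
Proof.
move=> [rf i_f] [rg ig]; split.
  apply: (eqint (integrableD _ rf rg)) => // x /=.
  by rewrite -EFinD; case: (f x) (g x) => [? ?] [? ?].
apply: (eqint (integrableD _ i_f ig)) => // x /=.
by rewrite -EFinD; case: (f x) (g x) => [? ?] [? ?].
Qed.

Lemma cintegralD f g : cintegrable f -> cintegrable g ->
  cintegral (fun x => f x + g x) = cintegral f + cintegral g.
Proof.
move=> [rf i_f] [rg ig]; rewrite /cintegral.
transitivity (Complex
   (\int[mu]_x (complex.Re (f x) + complex.Re (g x)))
   (\int[mu]_x (complex.Im (f x) + complex.Im (g x)))).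
  by congr Complex; apply: eq_Rintegral => x _;
     case: (f x) (g x) => [? ?] [? ?].
by rewrite !RintegralD.
Qed.

Lemma cintegralZ a f : cintegrable f ->
  cintegrable (fun x => a * f x) /\
  cintegral (fun x => a * f x) = a * cintegral f.
Proof.
case: a => a b [rf i_f].
have iZ c (h : T -> R) : mu.-integrable setT (EFin \o h) ->
    mu.-integrable setT (EFin \o (fun x => c * h x)).
  by move=> ih; apply: (eqint (integrableZl _ c ih)).
split.
  split.
    apply: (eqint (integrableB _ (iZ a _ rf) (iZ b _ i_f))) => //.
    by move=> x /=; rewrite -EFinB; case: (f x).
  apply: (eqint (integrableD _ (iZ a _ i_f) (iZ b _ rf))) => //.
  by move=> x /=; rewrite -EFinD; case: (f x).
rewrite /cintegral.
transitivity (Complex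
   (\int[mu]_x (a * complex.Re (f x) - b * complex.Im (f x)))
   (\int[mu]_x (a * complex.Im (f x) + b * complex.Re (f x)))).
  by congr Complex; apply: eq_Rintegral => x _; case: (f x).
by rewrite RintegralB ?RintegralD ?RintegralZl//; exact: iZ.
Qed.

Lemma cintegral_conj f : cintegrable f ->
  cintegral (fun x => (f x)^*) = (cintegral f)^*.
Proof.
move=> [rf i_f]; rewrite /cintegral.
transitivity (Complex (\int[mu]_x complex.Re (f x))
   (\int[mu]_x (-1 * complex.Im (f x)))).
  congr Complex; apply: eq_Rintegral => x _; case: (f x) => //= ? ?.
  by rewrite mulN1r.
by rewrite RintegralZl// mulN1r.
Qed.

Let cint_dot u v : cintegrable (fun x => u x * (v x)^*).
Proof. by apply: cintegrable_dot; exact: L2_funP. Qed.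

Lemma L2_dot_hermitian u v : L2_dot u v = (L2_dot v u)^*.
Proof.
rewrite /L2_dot -cintegral_conj//; congr cintegral; apply/funext => x.
by rewrite rmorphM /= conjCK mulrC.
Qed.

Let L2_dotPl w a u v :
  L2_dot (a *: u + v) w = a * L2_dot u w + L2_dot v w.
Proof.
have [iau <-] := cintegralZ a (cint_dot u w).
rewrite -cintegralD//; apply: eq_ae_cintegral => //.
  exact: cintegrableD.
near=> x; rewrite (near (L2_funD (a *: u) v) x)// (near (L2_funZ a u) x)//.
by rewrite mulrDl mulrA.
Unshelve. all: by end_near. Qed.

Let L2_dotPr w a u v :
  L2_dot w (a *: u + v) = a^* * L2_dot w u + L2_dot w v.
Proof.
rewrite L2_dot_hermitian L2_dotPl rmorphD rmorphM /=.
by rewrite -!L2_dot_hermitian.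
Qed.

HB.instance Definition _ := @bilinear_isBilinear.Build R[i] L2 L2 R[i] *%R
  (Num.conj \; *%R) L2_dot (L2_dotPl, L2_dotPr).

Let L2_dot_herm u v : L2_dot u v = (-1) ^+ false * Num.conj (L2_dot v u).
Proof. by rewrite expr0 mul1r -L2_dot_hermitian. Qed.

HB.instance Definition _ :=
  @isHermitianSesquilinear.Build R[i] L2 false Num.conj L2_dot L2_dot_herm.

Let sqr_abs (z : R[i]) : z * z^* = (complex.Re z ^+ 2 + complex.Im z ^+ 2)%:C%C.
Proof. by rewrite add_Re2_Im2 normCK. Qed.

Lemma L2_dot_gt0 u : u != 0 -> 0 < L2_dot u u.
Proof.
move=> u0; have [ir ii] := cint_dot u u.
have rE x : complex.Re (u x * (u x)^*) = complex.Re (u x) ^+ 2 + complex.Im (u x) ^+ 2.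
  by rewrite sqr_abs.
have -> : L2_dot u u = (\int[mu]_x complex.Re (u x * (u x)^*))%:C%C.
  rewrite /L2_dot /cintegral; congr Complex.
  transitivity (\int[mu]_x (0 : R)); last by rewrite Rintegral_cst// mul0r.
  by apply: eq_Rintegral => x _; rewrite sqr_abs.
rewrite ltcR lt_neqAle eq_sym; apply/andP; split; last first.
  by apply: Rintegral_ge0 => x _; rewrite rE addr_ge0 ?sqr_ge0.
apply: contra u0 => /eqP I0; apply/eqP/L2P.
have /ae_eq_integral_abs : (\int[mu]_x `|(EFin \o
     (fun x => complex.Re (u x * (u x)^*)%R)) x| = 0)%E.
  rewrite -[RHS]/(0%R%:E) -I0 /Rintegral fineK; last exact: integrable_fin_num.
  apply: eq_integral => x _ /=.
  by rewrite ger0_norm// rE addr_ge0 ?sqr_ge0.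
move=> /(_ measurableT (measurable_int _ ir)) h.
apply: filterS2 h L2_fun0 => x /(_ I) [] /eqP + ->.
rewrite rE paddr_eq0 ?sqr_ge0// !sqrf_eq0; case: (u x) => a b /=.
by move=> /andP[/eqP -> /eqP ->].
Qed.

HB.instance Definition _ := @isDotProduct.Build R[i] L2 L2_dot L2_dot_gt0.

Definition L2_norm u : R[i] := sqrtC (L2_dot u u).

Let L2_normD u v : L2_norm (u + v) <= L2_norm u + L2_norm v.
Proof. exact: (dot_triangle (L2_dot : {dot L2 for Num.conj})). Qed.

Let L2_normZ a u : L2_norm (a *: u) = `|a| * L2_norm u.
Proof.
rewrite /L2_norm dnormZ.
by rewrite sqrtCM ?nnegrE ?dnorm_ge0//; congr (_ * _); apply: sqrCK.
Qed.

Let L2_norm0_eq0 u : L2_norm u = 0 -> u = 0.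
Proof. by move=> /eqP; rewrite sqrt_dnorm_eq0 => /eqP. Qed.

HB.instance Definition _ := Lmodule_isNormed.Build R[i] L2
  L2_normD L2_normZ L2_norm0_eq0.

End complex_L2.
Arguments L2_of {d T R mu} f.
Arguments L2_dot {d T R mu} u v.

Lemma L2_normE d (T : measurableType d) (R : realType)
    (mu : {measure set T -> \bar R}) (u : L2 mu) :
  `|u| = sqrtC (L2_dot u u).
Proof. by []. Qed.


Section unbounded_operators.
Context {R : realType}.

(* the values of [op] outside [dom] are irrelevant *)
Record operator (H : lmodType R[i]) := Operator {
  dom : set H ;
  op :> H -> H ;
  dom0 : dom 0 ;
  domP : forall (a : R[i]) u v, dom u -> dom v -> dom (a *: u + v) ;
  opP : forall (a : R[i]) u v, dom u -> dom v ->
    op (a *: u + v) = a *: op u + op v }.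

Context {H : normedModType R[i]}.
Implicit Types (A : operator H) (z : R[i]).

Definition graph A : set (H * H) := [set p | dom A p.1 /\ p.2 = A p.1].

Definition closed_operator A := closed (graph A).

(* [w = A^* v] iff [<A u, v> = <u, w>] for all [u] in the domain of [A] *)
Definition adjoint_graph (dot : H -> H -> R[i]) A : set (H * H) :=
  [set p | forall u, dom A u -> dot (A u) p.1 = dot u p.2].

Definition self_adjoint (dot : H -> H -> R[i]) A :=
  dense (dom A) /\ graph A = adjoint_graph dot A.

(* [(A - z)^-1 u], for [z] in the resolvent set *)
Definition resolvent A z (u : H) : H :=
  xget 0 [set w | dom A w /\ A w - z *: w = u].

Definition resolvent_set A : set R[i]^o :=
  [set z | set_bij (dom A) setT (fun w => A w - z *: w) /\
           exists M : R[i], forall u, `|resolvent A z u| <= M * `|u|].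

Definition spectrum A : set R[i]^o := ~` resolvent_set A.

Definition eigenspace A z : set H := [set u | dom A u /\ A u = z *: u].

Definition eigenvalue A z := exists2 u, eigenspace A z u & u != 0.

(* the eigenspace is finite dimensional *)
Definition finite_multiplicity A z :=
  exists n (b : 'I_n -> H), forall u, eigenspace A z u ->
    exists c : 'I_n -> R[i], u = \sum_(j < n) c j *: b j.

Definition discrete_spectrum A : set R[i]^o :=
  [set z | [/\ eigenvalue A z, finite_multiplicity A z &
               isolated (spectrum A) z]].

Definition essential_spectrum A : set R[i]^o :=
  spectrum A `\` discrete_spectrum A.

Definition compact_operator (S : H -> H) :=
  precompact (S @` [set u | `|u| <= 1]).

Definition opnorm (S : H -> H) : \bar R :=
  ereal_sup [set (complex.Re `|S u|)%:E | u in [set u | `|u| <= 1]].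

End unbounded_operators.

Section rV_functions.
Context {R : realType} {d : nat}.
Implicit Types (f : 'rV[R]_d -> R) (x : 'rV[R]_d).

(* the norm [`|x|] of ['rV[R]_d] is the sup norm *)
Definition enorm x : R := Num.sqrt (\sum_(i < d) x ord0 i ^+ 2).

Definition eball x (r : R) : set 'rV[R]_d := [set y | enorm (y - x) < r].

Fixpoint iter_partial (s : seq 'I_d) f : 'rV[R]_d -> R :=
  if s is i :: s' then fun x => 'D_(delta_mx ord0 i) (iter_partial s' f) x
  else f.

(* all iterated partial derivatives exist and are continuous *)
Definition smooth f := forall s : seq 'I_d,
  continuous (iter_partial s f) /\
  forall i x, derivable (iter_partial s f) x (delta_mx ord0 i).

Definition supp f : set 'rV[R]_d := closure [set x | f x != 0].

Definition C0_infty f := smooth f /\ compact (supp f).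

Definition dilate f (k : nat) : 'rV[R]_d -> R := fun x => f (k%:R^-1 *: x).

End rV_functions.

Section L2_rV.
Context {R : realType} {d : nat}.
Local Notation H := (L2 (@lebesgue_rV R d)).
Implicit Types A : operator H.

(* [f] is bounded and measurable in all uses, so that the product is in [L2] *)
Definition mul_op (f : 'rV[R]_d -> R) (u : H) : H :=
  L2_of (fun x => (f x)%:C%C * u x).

Definition commutator A (f : 'rV[R]_d -> R) (u : H) : H :=
  A (mul_op f u) - mul_op f (A u).

Definition locally_compact_operator A :=
  [/\ closed_operator A, resolvent_set A !=set0 &
      forall B : set 'rV[R]_d, measurable B -> bounded_set B ->
        exists2 z, resolvent_set A z &
          compact_operator (fun u => mul_op \1_B (resolvent A z u))].

(* the complement of the largest open set on which [u] vanishes almost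
   everywhere *)
Definition ess_supp (u : H) : set 'rV[R]_d :=
  [set x | forall U, nbhs x U ->
    ~ \forall y \ae @lebesgue_rV R d, U y -> u y = 0].

Definition zhislin_sequence A (z : R[i]) (u : nat -> H) :=
  (forall k, [/\ dom A (u k), `|u k| = 1 &
     ess_supp (u k) `<=` ~` [set x | enorm x <= k%:R]]) /\
  (fun k => A (u k) - z *: u k) @ \oo --> (0 : H).

Definition zhislin_spectrum A : set R[i]^o :=
  [set z | exists u, zhislin_sequence A z u].

End L2_rV.

(* Main.v *)
(* The resolvents at non-real points exist by self-adjointness, so both spectra
   are treated at a real point [lam], through a dichotomy for [B = A - lam].

   If [lam] is isolated in the spectrum, then [|B^2 u| >= delta |B u|], whence
   every [u] in the domain is within [C |B u|] of the kernel of [B]. A Zhislin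
   sequence is weakly null because its supports escape to infinity; it would
   thus be asymptotic to a weakly null sequence of almost unit vectors in the
   kernel, which is impossible when the kernel is finite dimensional.

   Conversely, if on some bounded set [X] the unit vectors with [B u] small and
   [\1_X u] small do not exist, then [|u| <= C (|B u| + |\1_X u|)], and as
   [\1_X (A - z)^-1] is compact, [B] has a finite dimensional kernel and is
   bounded below on its orthogonal complement: [lam] is in the resolvent set or
   in the discrete spectrum. So for [lam] in the essential spectrum there are
   approximate eigenvectors [u] that are small on the support of [phi_k], and
   [u - phi_k u] is an approximate eigenvector supported away from the origin
   since [(A - lam)(u - phi_k u) = (1 - phi_k)(A - lam) u - [A, phi_k] u]. *)

Require Import Defs.
From mathcomp Require Import all_boot all_order all_algebra complex.
From mathcomp Require Import sesquilinear finmap.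
From mathcomp Require Import all_classical all_reals all_analysis.
From mathcomp Require Import measurable_realfun ring lra.
Import Order.TTheory GRing.Theory Num.Theory.
Import numFieldNormedType.Exports.

Set Implicit Arguments.
Unset Strict Implicit.
Unset Printing Implicit Defensive.

Local Open Scope classical_set_scope.
Local Open Scope ring_scope.

(** * Real inner product and norm *)

Section real_inner_product.
Context {R : realType} {H : lmodType R[i]}.
Variable dot : {dot H for Num.conj}.
Implicit Types (u v w : H) (a : R) (z : R[i]).

(* Orthogonality to a complex subspace only depends on the real part of [dot]. *)
Definition real_ip u v : R := complex.Re (dot u v).
Definition real_nrm u : R := Num.sqrt (real_ip u u).

Lemma ipC u v : real_ip u v = real_ip v u.
Proof.
have ReJ z : complex.Re z^* = complex.Re z by case: z.
by rewrite /real_ip (hermC dot) expr0 mul1r ReJ.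
Qed.

Lemma ipDl u v w : real_ip (u + v) w = real_ip u w + real_ip v w.
Proof. by rewrite /real_ip linearDl /=; case: (dot u w) (dot v w) => [? ?] []. Qed.
Lemma ipDr u v w : real_ip w (u + v) = real_ip w u + real_ip w v.
Proof. by rewrite !(ipC w) ipDl. Qed.
Lemma ipNl u w : real_ip (- u) w = - real_ip u w.
Proof. by rewrite /real_ip linearNl /=; case: (dot u w). Qed.
Lemma ipNr u w : real_ip w (- u) = - real_ip w u.
Proof. by rewrite !(ipC w) ipNl. Qed.
Lemma ip0l w : real_ip 0 w = 0.
Proof. by rewrite /real_ip linear0l. Qed.
Lemma ip0r w : real_ip w 0 = 0.
Proof. by rewrite ipC ip0l. Qed.
Lemma ipZl a u w : real_ip (a%:C%C *: u) w = a * real_ip u w.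
Proof.
by rewrite /real_ip linearZl_LR /=; case: (dot u w) => x y /=; rewrite mul0r subr0.
Qed.
Lemma ipZr a u w : real_ip w (a%:C%C *: u) = a * real_ip w u.
Proof. by rewrite !(ipC w) ipZl. Qed.

Lemma ipZC z u v : real_ip (z *: u) v = real_ip u (z^* *: v).
Proof. by rewrite /real_ip linearZl_LR linearZr_LR /= conjCK. Qed.

Definition ipE := (ipDl, ipDr, ipNl, ipNr, ipZl, ipZr, ip0l, ip0r).

(** The multiples [z = 1] and [z = 'i] give the real and the imaginary part of the form, so
    identities proved for [real_ip] lift to [dot]. *)
Lemma dot_ip u v u' v' :
  (forall z, real_ip (z *: u) v = real_ip (z *: u') v') -> dot u v = dot u' v'.
Proof.
have E z x y : real_ip (z *: x) y = complex.Re (z * dot x y).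
  by rewrite /real_ip linearZl_LR.
move=> h; have := h 1; have := h 'i%C; rewrite !E.
move: (dot u v : R[i]) (dot u' v' : R[i]) => [a b] [a' b'] /=.
by rewrite !mul0r !mul1r !sub0r !subr0 => /oppr_inj -> ->.
Qed.

Lemma ip_dot u : dot u u = (real_ip u u)%:C%C.
Proof. by rewrite /real_ip RRe_real//; exact/ger0_real/dnorm_ge0. Qed.

Lemma ipxx_ge0 u : 0 <= real_ip u u.
Proof. by rewrite -ler0c -ip_dot dnorm_ge0. Qed.

Lemma ipxx u : real_ip u u = real_nrm u ^+ 2.
Proof. by rewrite sqr_sqrtr// ipxx_ge0. Qed.

Lemma nrm_ge0 u : 0 <= real_nrm u.
Proof. exact: sqrtr_ge0. Qed.

Lemma nrm_eq0 u : (real_nrm u == 0) = (u == 0).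
Proof. by rewrite -sqrf_eq0 -ipxx -(inj_eq (@complexI R)) -ip_dot dnorm_eq0. Qed.

Lemma nrm0 : real_nrm 0 = 0.
Proof. by apply/eqP; rewrite nrm_eq0. Qed.

Lemma nrm_gt0 u : u != 0 -> 0 < real_nrm u.
Proof. by move=> u0; rewrite lt_neqAle nrm_ge0 eq_sym nrm_eq0 u0. Qed.

Lemma nrmN u : real_nrm (- u) = real_nrm u.
Proof. by rewrite /real_nrm ipNl ipNr opprK. Qed.

Lemma nrmBC u v : real_nrm (u - v) = real_nrm (v - u).
Proof. by rewrite -nrmN opprB. Qed.

Lemma nrmZC z u : real_nrm (z *: u) = complex.Re `|z| * real_nrm u.
Proof.
have E : real_ip (z *: u) (z *: u) = complex.Re (`|z| ^+ 2 * dot u u).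
  by rewrite /real_ip linearZl_LR linearZr_LR mulrA -normCK.
have [x x0 zE] : exists2 x : R, 0 <= x & `|z| = x%:C%C.
  by exists (complex.Re `|z|); rewrite normc_def //= sqrtr_ge0.
rewrite /real_nrm E zE ip_dot -rmorphXn -rmorphM /= sqrtrM ?sqr_ge0//.
by rewrite sqrtr_sqr ger0_norm.
Qed.

Lemma nrmZ a u : real_nrm (a%:C%C *: u) = `|a| * real_nrm u.
Proof. by rewrite nrmZC normc_def /= expr0n addr0 sqrtr_sqr. Qed.

Lemma nrm_sqrD u v : real_nrm (u + v) ^+ 2 = real_nrm u ^+ 2 + 2 * real_ip u v + real_nrm v ^+ 2.
Proof. by rewrite -!ipxx !ipE (ipC v u); ring. Qed.

Lemma nrm_sqrB u v : real_nrm (u - v) ^+ 2 = real_nrm u ^+ 2 - 2 * real_ip u v + real_nrm v ^+ 2.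
Proof. by rewrite nrm_sqrD nrmN ipNr; ring. Qed.

(** Cauchy-Schwarz, by expanding the squared norm of [u] minus its projection on [v]. *)
Lemma ip_norm_le u v : `|real_ip u v| <= real_nrm u * real_nrm v.
Proof.
rewrite -(@ler_pXn2r _ 2)// ?nnegrE ?mulr_ge0 ?nrm_ge0//.
rewrite real_normK ?num_real// exprMn -!ipxx.
have [->|v0] := eqVneq v 0; first by rewrite !ipE mulr0 expr0n.
have vv : 0 < real_ip v v by rewrite ipxx exprn_gt0// nrm_gt0.
have : 0 <= real_ip (u - (real_ip u v / real_ip v v)%:C%C *: v) (u - (real_ip u v / real_ip v v)%:C%C *: v).
  by rewrite ipxx sqr_ge0.
have -> : real_ip (u - (real_ip u v / real_ip v v)%:C%C *: v) (u - (real_ip u v / real_ip v v)%:C%C *: v)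
  = (real_ip u u * real_ip v v - real_ip u v ^+ 2) / real_ip v v.
  by rewrite !ipE (ipC v u); field; rewrite gt_eqF.
by rewrite pmulr_lge0 ?invr_gt0// subr_ge0.
Qed.

Lemma ip_le u v : real_ip u v <= real_nrm u * real_nrm v.
Proof. exact: le_trans (ler_norm _) (ip_norm_le u v). Qed.

Lemma nrmD u v : real_nrm (u + v) <= real_nrm u + real_nrm v.
Proof.
rewrite -(@ler_pXn2r _ 2)// ?nnegrE ?addr_ge0 ?nrm_ge0// nrm_sqrD.
by have := ip_le u v; nra.
Qed.

Lemma nrmB u v : real_nrm (u - v) <= real_nrm u + real_nrm v.
Proof. by rewrite -(nrmN v) nrmD. Qed.

End real_inner_product.

(** * Projections and the resolvent set *)

Section rate.
Context {R : realType}.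
Implicit Types (x K e : R).

(** Most limits are taken along this explicit null sequence, so that convergence becomes a family of
    inequalities with a constant. *)
Definition rate (n : nat) : R := n.+1%:R^-1.

Lemma rate_gt0 n : 0 < rate n.
Proof. by rewrite invr_gt0 ltr0Sn. Qed.

Lemma rate_le1 n : rate n <= 1.
Proof. by rewrite invf_le1 ?ler1n ?ltr0Sn. Qed.

Lemma rate_le m n : (m <= n)%N -> rate n <= rate m.
Proof. by move=> mn; rewrite lef_pV2 ?posrE ?ltr0Sn// ler_nat ltnS. Qed.

Lemma rate_lt e : 0 < e -> exists N, forall n, (N <= n)%N -> rate n < e.
Proof.
move=> e0; have [N _ hN] := near_infty_natSinv_lt (PosNum e0).
by exists N => n /hN.
Qed.

(** This replaces the passage to the limit in an inequality. *)
Lemma le0_rate x K : (forall n, x <= K * rate n) -> x <= 0.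
Proof.
move=> h; rewrite leNgt; apply/negP => x0.
have K0 : 0 < K.
  by rewrite ltNge; apply/negP => K0; have := h 0; have := rate_gt0 0; nra.
have [N hN] := rate_lt (divr_gt0 x0 K0).
have := hN N (leqnn N); rewrite ltr_pdivlMr// => hx.
by have := h N; lra.
Qed.

End rate.

Section hilbert.
Context {R : realType} {H : lmodType R[i]}.
Variable dot : {dot H for Num.conj}.
Local Notation ip := (real_ip dot).
Local Notation nrm := (real_nrm dot).


(* Sequential completeness, for the one rate of convergence needed here. *)
Definition rate_complete := forall K (u : nat -> H),
  (forall m n, nrm (u m - u n) <= K * (rate m + rate n)) ->
  exists l, forall n, nrm (u n - l) <= K * rate n.
Hypothesis complete : rate_complete.

(** Points of [M] that nearly minimise the distance to [u] form a Cauchy sequence by the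
    parallelogram law; orthogonality is the first-order condition at the minimum. *)
Lemma projection (M : set H) u : M 0 ->
  (forall (a : R) x y, M x -> M y -> M (a%:C%C *: x + y)) ->
  (forall y, (forall e, 0 < e -> exists2 x, M x & nrm (y - x) < e) -> M y) ->
  exists2 p, M p & forall m, M m -> ip (u - p) m = 0.
Proof.
move=> M0 ML Mcl.
pose S := [set nrm (u - m) ^+ 2 | m in M].
have Sinf : has_inf S.
  split; first by exists (nrm (u - 0) ^+ 2), 0.
  by exists 0 => _ [m _ <-]; rewrite sqr_ge0.
have dM m : M m -> inf S <= nrm (u - m) ^+ 2.
  by move=> Mm; apply: ge_inf; [exact: Sinf.2|exists m].
have /choice[m hm] : forall n, exists m, M m /\
    nrm (u - m) ^+ 2 < inf S + rate n ^+ 2.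
  move=> n; have [_ [x Mx <-] hx] := inf_adherent (exprn_gt0 2 (rate_gt0 n)) Sinf.
  by exists x.
have [|l hl] := complete (u := m) (K := 2).
  move=> i j; have ri := @rate_gt0 R i; have rj := @rate_gt0 R j.
  rewrite -(@ler_pXn2r _ 2)// ?nnegrE ?nrm_ge0 ?mulr_ge0 ?addr_ge0 ?ltW//.
  have [Mi hi] := hm i; have [Mj hj] := hm j.
  (* The midpoint of [m i] and [m j] is at squared distance at least [inf S] from [u], which bounds
     the squared norm of [m i - m j] by [2 * (rate i ^+ 2 + rate j ^+ 2)]. *)
  have Mij : M ((2^-1)%:C%C *: m i + ((2^-1)%:C%C *: m j + 0)).
    by apply: (ML) => //; apply: ML.
  have := dM _ Mij; move: hi hj.
  rewrite -!ipxx addr0 !ipE.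
  rewrite !(ipC dot (m j)) !(ipC dot u) => hi hj h.
  have := mulr_gt0 ri rj; nra.
have Ml : M l.
  apply: Mcl => e e0; have [N hN] := rate_lt (divr_gt0 e0 (ltr0Sn R 1)).
  exists (m N); first exact: (hm N).1.
  rewrite nrmBC; apply: le_lt_trans (hl N) _.
  by have := hN N (leqnn N); lra.
exists l => // x Mx.
(* Moving [m n] by [s * rate n] along [x] cannot bring the squared distance below [inf S]; after
   division by [rate n] a bound of order [rate n] is left. The two signs give both inequalities. *)
have key s : s ^+ 2 = 1 -> s * ip (u - l) x <= 0.
  move=> s1; apply: (@le0_rate _ _ ((nrm x ^+ 2 + 1) / 2 + 2 * nrm x)) => n.
  have [Mn hn] := hm n; have rn := @rate_gt0 R n.
  have := dM _ (ML (s * rate n) _ _ Mx Mn).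
  have -> : u - ((s * rate n)%:C%C *: x + m n) = (u - m n) - (s * rate n)%:C%C *: x.
    by rewrite opprD addrA addrAC.
  rewrite nrm_sqrB ipZr nrmZ exprMn real_normK ?num_real// exprMn s1 mul1r.
  move=> h1.
  have h2 : s * ip (u - m n) x <= (nrm x ^+ 2 + 1) / 2 * rate n by nra.
  have -> : u - l = (u - m n) + (m n - l) by rewrite addrA subrK.
  have h3 : s * ip (m n - l) x <= 2 * rate n * nrm x.
    have := ip_norm_le dot (m n - l) x; have := hl n; have := nrm_ge0 dot x.
    rewrite ler_norml => x0 hln /andP[? ?].
    have : s = 1 \/ s = -1 by move/eqP: s1; rewrite sqrf_eq1 => /orP[]/eqP; auto.
    by move=> [] ->; nra.
  rewrite ipDl; nra.
by have := key 1; have := key (-1); rewrite sqrrN expr1n => /(_ erefl) ? /(_ erefl) ?; lra.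
Qed.

(** * Unbounded operators and their regular points *)

Section operator.
Variable A : operator H.
Implicit Types (z : R[i]) (u v w : H).

Lemma domZ z u : dom A u -> dom A (z *: u).
Proof. by move=> Du; rewrite -[_ *: _]addr0; apply: domP => //; exact: dom0. Qed.

Lemma domD u v : dom A u -> dom A v -> dom A (u + v).
Proof. by move=> Du Dv; rewrite -[u]scale1r; apply: domP. Qed.

Lemma domB u v : dom A u -> dom A v -> dom A (u - v).
Proof. move=> Du Dv; rewrite -scaleN1r; apply: domD => //; exact: domZ. Qed.

Lemma domN u : dom A u -> dom A (- u).
Proof. by move=> Du; rewrite -scaleN1r; exact: domZ. Qed.

Lemma opD u v : dom A u -> dom A v -> A (u + v) = A u + A v.
Proof. by move=> Du Dv; rewrite -{1}[u]scale1r opP// scale1r. Qed.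

Lemma op0 : A 0 = 0.
Proof. by apply: (addIr (A 0)); rewrite -opD ?addr0 ?add0r//; exact: dom0. Qed.

Lemma opZ z u : dom A u -> A (z *: u) = z *: A u.
Proof.
by move=> Du; rewrite -[_ *: u]addr0 opP ?op0 ?addr0//; exact: dom0.
Qed.

Lemma opN u : dom A u -> A (- u) = - A u.
Proof. by move=> Du; rewrite -scaleN1r opZ// scaleN1r. Qed.

Lemma opB u v : dom A u -> dom A v -> A (u - v) = A u - A v.
Proof.
by move=> Du Dv; rewrite opD ?opN//; exact: domN.
Qed.

Lemma shiftD z u v : dom A u -> dom A v ->
  A (u + v) - z *: (u + v) = (A u - z *: u) + (A v - z *: v).
Proof. by move=> Du Dv; rewrite opD// scalerDr opprD addrACA. Qed.

Lemma shiftZ z a u : dom A u -> A (a *: u) - z *: (a *: u) = a *: (A u - z *: u).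
Proof. by move=> Du; rewrite opZ// scalerBr !scalerA mulrC. Qed.

Lemma shiftB z u v : dom A u -> dom A v ->
  A (u - v) - z *: (u - v) = (A u - z *: u) - (A v - z *: v).
Proof.
by move=> Du Dv; rewrite opB// scalerBr !opprD !opprK addrACA.
Qed.

(** The two clauses are the two inclusions between [A] and its adjoint. *)
Definition ip_self_adjoint :=
  (forall u v, dom A u -> dom A v -> ip (A u) v = ip u (A v)) /\
  (forall v w, (forall u, dom A u -> ip (A u) v = ip u w) ->
    dom A v /\ A v = w).

(* the resolvent set, with [A - z] bounded below instead of a bounded inverse *)
Definition regular z :=
  (exists2 c : R, 0 < c &
    forall u, dom A u -> c * nrm u <= nrm (A u - z *: u)) /\
  (forall w, exists2 u, dom A u & A u - z *: u = w).

Hypothesis sa : ip_self_adjoint.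

(** Adjoints are closed: symmetry against a fixed [u] in the domain passes to the limit, and the
    second clause of self-adjointness puts the limit in the domain. *)
Lemma self_adjoint_closed (x : nat -> H) l y (K K' : R) :
  (forall n, dom A (x n)) -> (forall n, nrm (x n - l) <= K * rate n) ->
  (forall n, nrm (A (x n) - y) <= K' * rate n) -> dom A l /\ A l = y.
Proof.
move=> Dx xl Axy; apply: sa.2 => u Du.
apply/eqP; rewrite -subr_eq0 -normr_le0; apply/eqP.
apply/eqP; apply: (@le0_rate _ _ (K * nrm (A u) + K' * nrm u)) => n.
have -> : ip (A u) l - ip u y = ip u (A (x n) - y) - ip (A u) (x n - l).
  by rewrite !ipE (sa.1 u (x n))//; ring.
apply: le_trans (ler_normB _ _) _.
have := ip_norm_le dot u (A (x n) - y); have := ip_norm_le dot (A u) (x n - l).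
have := xl n; have := Axy n; have := nrm_ge0 dot u; have := nrm_ge0 dot (A u); nra.
Qed.

Lemma shift_ip (m : R) u v : dom A u -> dom A v ->
  ip (A u - m%:C%C *: u) v = ip u (A v - m%:C%C *: v).
Proof. by move=> Du Dv; rewrite !ipE sa.1. Qed.

(** The lower bound makes the range of [A - z] closed, and a vector orthogonal to the range lies in
    the kernel of the adjoint [A - z^*], which is trivial by hypothesis. *)
Lemma bounded_below_regular z (c : R) : 0 < c ->
  (forall u, dom A u -> c * nrm u <= nrm (A u - z *: u)) ->
  (forall v, dom A v -> A v = z^* *: v -> v = 0) -> regular z.
Proof.
move=> c0 hc ker0; pose B u := A u - z *: u.
have inj : {in dom A &, injective B}.
  move=> u v; rewrite !inE => Du Dv uv; apply/subr0_eq/eqP.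
  rewrite -(nrm_eq0 dot) eq_le nrm_ge0 andbT.
  by have := hc _ (domB Du Dv); rewrite shiftB// -/(B u) -/(B v) uv subrr nrm0 pmulr_rle0.
have surj : forall w, exists2 u, dom A u & B u = w.
  move=> w; pose M := [set B u | u in dom A].
  have [||y hy|p [u Du <-] hp] := projection (M := M) w.
  - by exists 0; rewrite /B ?op0 ?scaler0 ?subr0//; exact: dom0.
  - move=> a _ _ [x Dx <-] [y Dy <-]; exists (a%:C%C *: x + y); first exact: domP.
    by rewrite /B shiftD ?shiftZ//; exact: domZ.
  - have /choice[x hx] : forall n, exists x, dom A x /\ nrm (y - B x) < rate n.
      by move=> n; have [_ [x Dx <-] ?] := hy _ (rate_gt0 n); exists x.
    have [|l hl] := complete (u := x) (K := c^-1).
      move=> i j; have [[Di hi] [Dj hj]] := (hx i, hx j).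
      rewrite mulrC ler_pdivlMr// mulrC; apply: (le_trans (hc _ (domB Di Dj))).
      rewrite shiftB// -/(B _) -/(B _).
      have -> : B (x i) - B (x j) = (y - B (x j)) - (y - B (x i)).
        by rewrite (opprB y) [RHS]addrC subrKA.
      by apply: le_trans (nrmB _ _ _) _; rewrite addrC lerD// ltW.
    have [Dl El] : dom A l /\ A l = y + z *: l.
      apply: (@self_adjoint_closed x _ _ c^-1 (1 + complex.Re `|z| * c^-1)) => //.
        by move=> n; exact: (hx n).1.
      move=> n; have -> : A (x n) - (y + z *: l) = (B (x n) - y) + z *: (x n - l).
        by rewrite /B scalerBr (addrAC (A _)) subrKA opprD addrA.
      apply: le_trans (nrmD _ _ _) _; rewrite nrmZC mulrDl mul1r lerD//.
        rewrite nrmBC; apply: ltW; exact: (hx n).2.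
      rewrite -mulrA ler_wpM2l//.
      by have := normr_ge0 z; rewrite lecE => /andP[].
    by exists l => //; rewrite /B El addrK.
  have q0 : w - B u = 0.
    have [Dq Eq] : dom A (w - B u) /\ A (w - B u) = z^* *: (w - B u).
      apply: sa.2 => x Dx; apply/eqP; rewrite -subr_eq0 -ipZC.
      rewrite -ipNl -ipDl ipC hp//; by exists x.
    exact: ker0.
  by exists u => //; rewrite -[w](subrK (B u)) q0 add0r.
by split; [exists c|].
Qed.

End operator.
End hilbert.

(** * Spectral gaps *)

Section gap.
Context {R : realType} {H : lmodType R[i]}.
Variable dot : {dot H for Num.conj}.
Local Notation ip := (real_ip dot).
Local Notation nrm := (real_nrm dot).

Hypothesis complete : rate_complete dot.
Variable A : operator H.
Hypothesis sa : ip_self_adjoint dot A.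

(* If [c < r] were the best lower bound, then [S = (A - m)^-1] would have norm
   [1 / c], and [|S^2 f - c^-2 f|^2 <= c^-2 (c^-2 |f|^2 - |S f|^2)]. But
   [S^2 - c^-2] is bounded below since [m - c] and [m + c] are regular, which
   gives a better bound than [c]. *)
Lemma gap_bounded_below (m r : R) : 0 < r ->
  (forall t : R, `|t - m| < r -> regular dot A t%:C%C) ->
  forall u, dom A u -> r * nrm u <= nrm (A u - m%:C%C *: u).
Proof.
move=> r0 rho u0 Du0; pose B u := A u - m%:C%C *: u; rewrite -/(B u0).
rewrite leNgt; apply/negP => lt0.
have rm : regular dot A m%:C%C by apply: rho; rewrite subrr normr0.
have [[c0 c0_gt0 hc0] surj] := rm.
have nu0 : 0 < nrm u0.
  by rewrite -(pmulr_rgt0 _ r0); apply: le_lt_trans lt0; exact: nrm_ge0.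
pose L := [set l : R | 0 <= l /\
  forall u, dom A u -> l * nrm u ^+ 2 <= nrm (B u) ^+ 2].
have Lc0 : L (c0 ^+ 2).
  split; first exact: sqr_ge0.
  move=> u Du; rewrite -exprMn ler_pXn2r ?nnegrE ?nrm_ge0 ?mulr_ge0 ?(ltW c0_gt0)//.
  - exact: hc0.
  - exact: nrm_ge0.
have Lub l : L l -> l < r ^+ 2.
  move=> [l0 /(_ _ Du0) hl].
  have h2 : nrm (B u0) ^+ 2 < (r * nrm u0) ^+ 2.
    by rewrite ltr_pXn2r ?nnegrE ?nrm_ge0// mulr_ge0 ?ltW.
  by have := le_lt_trans hl h2; rewrite exprMn ltr_pM2r// exprn_gt0.
have Lsup : has_sup L.
  by split; [exists (c0 ^+ 2)|exists (r ^+ 2) => l /Lub/ltW].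
pose l0 := sup L.
have c0l0 : c0 ^+ 2 <= l0 by apply: ub_le_sup => //; exact: Lsup.2.
have l0_gt0 : 0 < l0 by apply: lt_le_trans c0l0; rewrite exprn_gt0.
have Ll0 : L l0.
  split; first exact: ltW.
  move=> u Du; have [u_eq0|un0] := eqVneq (nrm u) 0.
    by rewrite u_eq0 expr0n /= mulr0 sqr_ge0.
  have un : 0 < nrm u ^+ 2 by rewrite exprn_gt0// lt_neqAle eq_sym un0 nrm_ge0.
  rewrite -ler_pdivlMr//; apply: ge_sup; first exact: Lsup.1.
  by move=> l [_ hl]; rewrite ler_pdivlMr//; exact: hl.
have l0r := Lub _ Ll0.
pose c := Num.sqrt l0.
have c_gt0 : 0 < c by rewrite sqrtr_gt0.
have cc : c ^+ 2 = l0 by rewrite sqr_sqrtr// ltW.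
have cr : c < r by rewrite -(@ltr_pXn2r _ 2)// ?nnegrE ?ltW// cc.
have [c1 c1_gt0 hc1] : exists2 c1 : R, 0 < c1 & forall u, dom A u ->
    c1 * nrm u <= nrm (B u - c%:C%C *: u).
  have /rho[[c1 c10 hc1] _] : `|(m + c) - m| < r.
    by rewrite addrAC subrr add0r gtr0_norm.
  exists c1 => // u Du; have := hc1 u Du.
  by rewrite rmorphD scalerDl opprD addrA.
have [c2 c2_gt0 hc2] : exists2 c2 : R, 0 < c2 & forall u, dom A u ->
    c2 * nrm u <= nrm (B u + c%:C%C *: u).
  have /rho[[c2 c20 hc2] _] : `|(m - c) - m| < r.
    by rewrite addrAC subrr add0r normrN gtr0_norm.
  exists c2 => // u Du; have := hc2 u Du.
  by rewrite rmorphB scalerBl opprB addrA addrAC.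
pose k := c1 * c2; have k0 : 0 < k by rewrite mulr_gt0.
(* The number [1 + c ^+ 2 / k] bounds [|f| / |f - c^2 S^2 f|], where [k] is a lower bound for the
   product of [B - c] and [B + c]. *)
pose F := (1 + c ^+ 2 / k) ^+ 2.
have F1 : 1 < F.
  by rewrite expr_gt1// ?ltrDl ?addr_ge0 ?divr_gt0 ?exprn_gt0// ltW// divr_gt0// exprn_gt0.
have key v : dom A v -> l0 * F * nrm v ^+ 2 <= (F - 1) * nrm (B v) ^+ 2.
  move=> Dv; have [u Du Bu] := surj v; rewrite -/(B u) in Bu.
  pose f := B v.
  have hx : k * nrm u <= nrm (f - l0%:C%C *: u).
    have Dx : dom A (B u + c%:C%C *: u) by rewrite Bu; apply: domD => //; exact: domZ.
    have := hc1 _ Dx; have := hc2 _ Du.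
    have -> : B (B u + c%:C%C *: u) - c%:C%C *: (B u + c%:C%C *: u) = f - l0%:C%C *: u.
      rewrite /B shiftD ?shiftZ -/(B _) ?Bu//; last exact: domZ.
      rewrite -/(B u) Bu scalerDr scalerA -rmorphM -expr2 cc opprD addrA.
      by rewrite addrK.
    rewrite /k -mulrA => h2 h1; apply: le_trans h1.
    by rewrite ler_pM2l.
  have fu : ip f u = nrm v ^+ 2.
    by rewrite /f (shift_ip sa)// -/(B u) Bu ipxx.
  have [_ /(_ _ Du)] := Ll0; rewrite Bu => lu.
  have hq : nrm (f - l0%:C%C *: u) ^+ 2 <= nrm f ^+ 2 - l0 * nrm v ^+ 2.
    rewrite nrm_sqrB ipZr fu nrmZ exprMn real_normK ?num_real//; nra.
  have hf : nrm f <= (1 + c ^+ 2 / k) * nrm (f - l0%:C%C *: u).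
    have -> : nrm f = nrm ((f - l0%:C%C *: u) + l0%:C%C *: u) by rewrite subrK.
    apply: le_trans (nrmD _ _ _) _; rewrite mulrDl mul1r lerD2l nrmZ gtr0_norm//.
    by rewrite cc -mulrA ler_pM2l// mulrC ler_pdivlMr// mulrC.
  have : nrm f ^+ 2 <= F * nrm (f - l0%:C%C *: u) ^+ 2.
    rewrite -exprMn ler_pXn2r// ?nnegrE ?nrm_ge0//.
    by apply: le_trans hf; exact: nrm_ge0.
  rewrite -/f; nra.
(* By [key] this number is in [L], but [F / (F - 1) > 1] makes it exceed the supremum. *)
have : l0 * F / (F - 1) <= l0.
  apply: ub_le_sup; first exact: Lsup.2.
  have F1' : 0 < F - 1 by rewrite subr_gt0.
  split; first by rewrite ltW// divr_gt0// mulr_gt0// (lt_trans ltr01).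
  move=> v Dv; rewrite mulrAC ler_pdivrMr// [X in _ <= X]mulrC; exact: key.
rewrite ler_pdivrMr ?subr_gt0//; nra.
Qed.

(** With [B = A - lam], the vector [p] is the limit of [- s (B - s)^-1 u] as [s] tends to [0]: the
    projection of [u] on the kernel of [B], obtained from resolvents alone. *)
Lemma isolated_near_eigenspace (lam d : R) : 0 < d ->
  (forall t : R, 0 < `|t - lam| < 2 * d -> regular dot A t%:C%C) ->
  forall u, dom A u -> exists p, [/\ dom A p, A p = lam%:C%C *: p &
    2 * d * nrm (u - p) <= nrm (A u - lam%:C%C *: u)].
Proof.
move=> d0 rho; have [B BE] : exists B : H -> H, forall u, B u = A u - lam%:C%C *: u by eexists.
(* The open interval of radius [|s|] around [lam + s] omits [lam] and stays within distance [2 * d]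
   of it. *)
have gap (s : R) : 0 < `|s| <= d -> forall u, dom A u ->
    `|s| * nrm u <= nrm (B u - s%:C%C *: u).
  move=> /andP[s0 sd] u Du.
  have -> : B u - s%:C%C *: u = A u - (lam + s)%:C%C *: u.
    by rewrite BE rmorphD scalerDl opprD addrA.
  apply: gap_bounded_below => // t ht; apply: rho.
  have -> : t - lam = (t - (lam + s)) + s by ring.
  apply/andP; split; last by apply: le_lt_trans (ler_normD _ _) _; lra.
  have := lerB_normD s (t - (lam + s)).
  by rewrite [s + _]addrC; lra.
have BD u v : dom A u -> dom A v -> B (u + v) = B u + B v.
  by move=> Du Dv; rewrite !BE shiftD.
have BZ a u : dom A u -> B (a *: u) = a *: B u by move=> Du; rewrite !BE shiftZ.
have BB u v : dom A u -> dom A v -> B (u - v) = B u - B v.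
  by move=> Du Dv; rewrite !BE shiftB.
have form (s : R) u : 0 < `|s| <= d -> dom A u -> 2 * s * ip (B u) u <= nrm (B u) ^+ 2.
  move=> sd Du; have := gap _ sd _ Du.
  rewrite -(@ler_pXn2r _ 2)// ?nnegrE ?mulr_ge0 ?nrm_ge0// exprMn real_normK ?num_real//.
  rewrite nrm_sqrB ipZr nrmZ exprMn real_normK ?num_real//; lra.
(* B^2 (B^2 - 4d^2) >= 0, from B^2 -+ 2dB >= 0 applied to (B +- 2d) u *)
have range u : dom A u -> dom A (B u) -> 2 * d * nrm (B u) <= nrm (B (B u)).
  move=> Du DBu; pose v := B u; pose e := (2 * d)%:C%C.
  have Deu : dom A (e *: u) by exact: domZ.
  have sd : 0 < `|d| <= d by rewrite gtr0_norm ?d0 /=.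
  have sd' : 0 < `|- d| <= d by rewrite normrN.
  have := form _ _ sd (domD DBu Deu).
  have := form _ _ sd' (domB DBu Deu).
  rewrite BB// BD// BZ// -/v /e -!ipxx !ipE !(ipC dot (B v)).
  have -> : ip u (B v) = ip v v by rewrite !BE -(shift_ip sa) -?BE.
  have -> : ip v u = ip u v by rewrite ipC.
  rewrite !ipxx => h1 h2.
  rewrite -(@ler_pXn2r _ 2)// ?nnegrE ?nrm_ge0 ?mulr_ge0 ?nrm_ge0 ?(ltW d0)//.
  rewrite exprMn; nra.
move=> u Du.
pose e n : R := d * rate n.
have e0 n : 0 < e n by rewrite mulr_gt0// rate_gt0.
have ed n : 0 < `|e n| <= d.
  by rewrite gtr0_norm// e0 /= -[leRHS]mulr1 ler_pM2l// rate_le1.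
have /choice[w Dw] : forall n, exists w,
    dom A w /\ B w - (e n)%:C%C *: w = u.
  move=> n; have [_ /(_ u)[w Dw wE]] : regular dot A (lam + e n)%:C%C.
    apply: rho; rewrite addrAC subrr add0r; have /andP[-> /=] := ed n.
    by move=> h; lra.
  by exists w; split => //; rewrite BE -[RHS]wE rmorphD scalerDl opprD addrA.
have ew n : e n * nrm (w n) <= nrm u.
  by have := gap _ (ed n) _ (Dw n).1; rewrite (Dw n).2 gtr0_norm.
pose p n := u - B (w n).
have pE n : p n = - (e n)%:C%C *: w n.
  by rewrite /p -[X in X - _](Dw n).2 scaleNr addrAC subrr add0r.
have Dp n : dom A (p n) by have [? _] := Dw n; rewrite pE; exact: domZ.
have DB n : dom A (B (w n)) by rewrite -[B _](subKr u) -/(p n); apply: domB.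
have Bwu n : nrm (B (w n)) <= 2 * nrm u.
  rewrite -[B _](subrK ((e n)%:C%C *: w n)) (Dw n).2.
  apply: le_trans (nrmD _ _ _) _; rewrite nrmZ gtr0_norm//.
  by have := ew n; lra.
have Bp n : B (p n) = - (e n)%:C%C *: B (w n) by rewrite pE BZ//; exact: (Dw n).1.
(* The difference [p i - p j] is in the range of [B], so [range] bounds it by its image, which is
   small since [B (p n)] is [- e n] times the bounded vector [B (w n)]. *)
have [|l hl] := complete (u := p) (K := nrm u).
  move=> i j.
  have pij : p i - p j = B (w j - w i).
    have [[Di _] [Dj _]] := (Dw i, Dw j).
    by rewrite BB// /p (opprB u) [LHS]addrC subrKA.
  have := range _ (domB (Dw j).1 (Dw i).1); rewrite -pij.
  move=> /(_ (domB (Dp i) (Dp j))); rewrite BB// !Bp.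
  have := nrmB dot (- (e i)%:C%C *: B (w i)) (- (e j)%:C%C *: B (w j)).
  rewrite -!rmorphN !nrmZ !normrN !gtr0_norm// => h1 h2.
  have := Bwu i; have := Bwu j; have := e0 i; have := e0 j.
  rewrite /e in h1 h2 *; have := @rate_gt0 R i; have := @rate_gt0 R j.
  move=> rj ri ? ? hj hi.
  have h3 : d * rate i * nrm (B (w i)) <= d * rate i * (2 * nrm u) by rewrite ler_wpM2l// ltW.
  have h4 : d * rate j * nrm (B (w j)) <= d * rate j * (2 * nrm u) by rewrite ler_wpM2l// ltW.
  have : d * nrm (p i - p j) <= d * (nrm u * (rate i + rate j)) by lra.
  by rewrite ler_pM2l.
have [Dl Al] : dom A l /\ A l = lam%:C%C *: l.
  apply: (self_adjoint_closed sa (x := p) (K := nrm u)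
    (K' := 2 * d * nrm u + `|lam| * nrm u)) => // n.
  have E x : A x - lam%:C%C *: l = B x + lam%:C%C *: (x - l).
    by rewrite BE scalerBr subrKA.
  rewrite E; apply: le_trans (nrmD _ _ _) _; rewrite Bp -rmorphN !nrmZ normrN gtr0_norm//.
  rewrite mulrDl lerD//; last by rewrite -mulrA ler_wpM2l.
  by rewrite /e; have := Bwu n; have := mulr_gt0 d0 (@rate_gt0 R n); nra.
(* As [u - p n = B (w n)], [range] at [w n] gives the bound up to a term of order [rate n], because
   [B (B (w n))] differs from [B u] by [e n] times [B (w n)]. *)
exists l; split => //; rewrite -subr_le0.
apply: (@le0_rate _ _ (2 * d * nrm u + 2 * d * nrm u)) => n.
have h1 : nrm (u - l) <= nrm (B (w n)) + nrm (p n - l).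
  by apply: le_trans (nrmD _ _ _); rewrite /p addrA subrKC.
have h2 := range _ (Dw n).1 (DB n).
have h3 : nrm (B (B (w n))) <= nrm (B u) + e n * nrm (B (w n)).
  have -> : B (B (w n)) = B u + (e n)%:C%C *: B (w n).
    rewrite -[X in B X + _](Dw n).2 BB ?BZ ?subrK//; [exact: (Dw n).1|exact: domZ (Dw n).1].
  by apply: le_trans (nrmD _ _ _) _; rewrite nrmZ gtr0_norm.
have h4 := hl n; have h5 := Bwu n; have := @rate_gt0 R n => rn.
rewrite /e in h3; rewrite -BE.
have h6 : d * rate n * nrm (B (w n)) <= d * rate n * (2 * nrm u).
  by rewrite ler_pM2l// mulr_gt0.
have h7 : d * nrm (u - l) <= d * (nrm (B (w n)) + nrm u * rate n).
  by rewrite ler_pM2l//; lra.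
lra.
Qed.

End gap.

(** * Orthonormal families *)

Section orthonormalR.
Context {R : realType} {H : lmodType R[i]}.
Variable dot : {dot H for Num.conj}.
Local Notation ip := (real_ip dot).
Local Notation nrm := (real_nrm dot).
Implicit Types (e : seq H) (u v x : H).

Definition oproj e u : H := \sum_(x <- e) (ip u x)%:C%C *: x.

(** Orthonormality over the reals: a unit vector [x] and ['i *: x] count as two orthogonal
    directions. *)
Fixpoint orthonormalR e : Prop :=
  if e is x :: e' then
    [/\ nrm x = 1, (forall y, y \in e' -> ip x y = 0) & orthonormalR e']
  else True.

Lemma oproj_cons x e u : oproj (x :: e) u = (ip u x)%:C%C *: x + oproj e u.
Proof. by rewrite /oproj big_cons. Qed.

Lemma oproj_ip0 e u x : (forall y, y \in e -> ip x y = 0) -> ip (oproj e u) x = 0.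
Proof.
elim: e => [|y e ih] h; first by rewrite /oproj big_nil ipE.
rewrite oproj_cons !ipE (ipC dot y) h ?mem_head// mulr0 add0r ih// => z ze.
by rewrite h// inE ze orbT.
Qed.

Lemma oproj_orthogonal e u x : orthonormalR e -> x \in e -> ip (u - oproj e u) x = 0.
Proof.
elim: e u => // y e ih u /= [y1 ye oe]; rewrite inE oproj_cons => /predU1P[->|xe].
  by rewrite !ipE (oproj_ip0 _ ye) ipxx y1; ring.
have := ih u oe xe; rewrite !ipE ye//; lra.
Qed.

Lemma oprojD e u v : oproj e (u + v) = oproj e u + oproj e v.
Proof.
rewrite /oproj -big_split /=; apply: eq_bigr => x _.
by rewrite ipDl rmorphD scalerDl.
Qed.

Lemma oprojZ e a u : oproj e (a%:C%C *: u) = a%:C%C *: oproj e u.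
Proof.
by rewrite /oproj scaler_sumr; apply: eq_bigr => x _; rewrite ipZl rmorphM scalerA.
Qed.

Lemma orthonormal_nrm e x : orthonormalR e -> x \in e -> nrm x = 1.
Proof.
by elim: e => // y e ih /= [y1 _ oe]; rewrite inE => /predU1P[->//|]; exact: ih.
Qed.

Lemma nrm_oproj e u b : orthonormalR e -> (forall x, x \in e -> `|ip u x| <= b) ->
  nrm (oproj e u) <= (size e)%:R * b.
Proof.
elim: e => [|y e ih] /=; first by rewrite /oproj big_nil nrm0 mul0r.
move=> [y1 _ oe] hb; rewrite oproj_cons; apply: le_trans (nrmD _ _ _) _.
rewrite -natr1 mulrDl mul1r addrC lerD//.
  by apply: ih => // x xe; rewrite hb// inE xe orbT.
by rewrite nrmZ y1 mulr1 hb// mem_head.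
Qed.

Lemma orthonormal_extend e u : orthonormalR e -> u != oproj e u ->
  exists2 a : R, 0 < a & let x := a%:C%C *: (u - oproj e u) in
    orthonormalR (x :: e) /\ oproj (x :: e) u = u.
Proof.
move=> oe ue; pose r := u - oproj e u.
have r0 : 0 < nrm r by apply: nrm_gt0; rewrite subr_eq0.
have re y : y \in e -> ip r y = 0 by exact: oproj_orthogonal.
have rr : ip u r = nrm r ^+ 2.
  rewrite -{1}[u](subrK (oproj e u)) -/r ipDl ipxx (oproj_ip0 _ re) addr0 //.
exists (nrm r)^-1; rewrite ?invr_gt0//= -/r; split.
  split => // [|y ye]; last by rewrite ipZl re ?mulr0.
  by rewrite nrmZ gtr0_norm ?invr_gt0// mulVf// gt_eqF.
rewrite oproj_cons ipZr rr scalerA -rmorphM /=.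
have -> : (nrm r)^-1 * nrm r ^+ 2 * (nrm r)^-1 = 1 by field; rewrite gt_eqF.
by rewrite scale1r subrK.
Qed.

Lemma gram_schmidt (b : seq H) :
  exists2 e, orthonormalR e & forall x, x \in b -> oproj e x = x.
Proof.
elim: b => [|u b [e oe he]]; first by exists [::].
have [ue|ue] := eqVneq u (oproj e u).
  by exists e => // x; rewrite inE => /predU1P[->|/he].
have [a a0 [oxe hu]] := orthonormal_extend oe ue.
eexists; first exact: oxe.
move=> x; rewrite inE => /predU1P[->//|xb].
rewrite oproj_cons; set r := u - _.
have -> : ip x (a%:C%C *: r) = 0.
  rewrite ipZr -(he _ xb) oproj_ip0 ?mulr0// => y ye.
  exact: oproj_orthogonal.
by rewrite scale0r add0r he.
Qed.

(** If no finite orthonormal family reproduces [E], any such family in [E] can be extended by the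
    normalised residual of a vector of [E], and the extension goes on forever. *)
Lemma orthonormal_dichotomy (E : set H) :
  (forall (a : R) u v, E u -> E v -> E (a%:C%C *: u + v)) -> E 0 ->
  (exists2 e, orthonormalR e & forall u, E u -> oproj e u = u) \/
  exists x : nat -> H, (forall n, E (x n) /\ nrm (x n) = 1) /\
    forall m n, (m < n)%N -> ip (x n) (x m) = 0.
Proof.
move=> EL E0; have [|ninf] := pselect (exists2 e, orthonormalR e &
  forall u, E u -> oproj e u = u); [by left|right].
pose good e := orthonormalR e /\ forall x, x \in e -> E x.
have Eproj e u : (forall x, x \in e -> E x) -> E (oproj e u).
  elim: e => [|y e ih] h; first by rewrite /oproj big_nil.
  rewrite oproj_cons; apply: (EL); first by apply: h; rewrite mem_head.
  by apply: ih => z ze; apply: h; rewrite inE ze orbT.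
(* The default [0] on lists that are not [good] makes the extension a total function. *)
have /choice[f fP] : forall e, exists x, good e -> good (x :: e).
  move=> e; have [ge|] := pselect (good e); last by exists 0.
  have [u Eu /eqP ue] : exists2 u, E u & oproj e u <> u.
    apply: contrapT => h; apply: ninf; exists e; first exact: ge.1.
    by move=> u Eu; apply: contrapT => hu; apply: h; exists u.
  have [|a a0 [oxe _]] := @orthonormal_extend e u ge.1; first by rewrite eq_sym.
  exists (a%:C%C *: (u - oproj e u)) => _; split => // x.
  rewrite inE => /predU1P[->|/(ge.2 _)//].
  rewrite -[_ *: _]addr0; apply: (EL) => //.
  rewrite addrC -[- _]scaleN1r -[-1](rmorphN1 (real_complex R)); apply: (EL) => //.
  exact: Eproj ge.2.
(* The list [s n] keeps all the earlier vectors, so that the next one is orthogonal to each. *)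
pose s := fix s n := if n is m.+1 then f (s m) :: s m else [::].
have gs n : good (s n) by elim: n => [|n ih]; [split|exact: fP].
exists (fun n => f (s n)); split=> [n|m n mn].
  have [/= [? _ _] h] := gs n.+1; split => //; apply: h; exact: mem_head.
have [/= [_ h _] _] := gs n.+1; apply: h.
elim: n mn => // n ih; rewrite ltnS leq_eqVlt => /predU1P[->|/ih fs] /=.
  exact: mem_head.
by rewrite inE fs orbT.
Qed.

End orthonormalR.

(** * Singular sequences and compactness *)

Section fredholm.
Context {R : realType} {H : lmodType R[i]}.
Variable dot : {dot H for Num.conj}.
Local Notation ip := (real_ip dot).
Local Notation nrm := (real_nrm dot).
Hypothesis complete : rate_complete dot.
Variable A : operator H.
Hypothesis sa : ip_self_adjoint dot A.

(** With [x] and [y] the real and imaginary parts of [z], symmetry of [A - x] makes [(A - x) u]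
    orthogonal to ['i *: u], and Pythagoras isolates the contribution of [y]. *)
Lemma nonreal_bounded_below (z : R[i]) u : dom A u ->
  `|complex.Im z| * nrm u <= nrm (A u - z *: u).
Proof.
case: z => x y Du /=; pose B u := A u - x%:C%C *: u.
have -> : A u - (x +i* y)%C *: u = B u - y%:C%C *: ('i%C *: u).
  rewrite /B -addrA -opprD scalerA -scalerDl.
  by rewrite [(x +i* y)%C]complexE /= [_ * 'i%C]mulrC.
have Bi : ip (B u) ('i%C *: u) = 0.
  have h1 : ip (B u) ('i%C *: u) = ip ('i%C *: B u) u.
    rewrite (shift_ip sa) ?shiftZ//; last exact: domZ.
    by rewrite ipC.
  have h2 : ip ('i%C *: B u) u = - ip (B u) ('i%C *: u).
    have E : ('i%C : R[i])^* = - 'i%C by apply/eqP; rewrite eq_complex /= oppr0 !eqxx.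
    by rewrite ipZC E scaleNr ipNr.
  by lra.
rewrite -(@ler_pXn2r _ 2)// ?nnegrE ?mulr_ge0 ?nrm_ge0// exprMn nrm_sqrB ipZr Bi.
rewrite nrmZ nrmZC exprMn normc_def /= expr0n add0r expr1n sqrtr1 mul1r.
by rewrite !real_normK ?num_real//; have := sqr_ge0 (nrm (B u)); lra.
Qed.

(** The same lower bound at [z^*] removes the kernel of the adjoint. *)
Lemma nonreal_regular (z : R[i]) : complex.Im z != 0 -> regular dot A z.
Proof.
move=> z0; apply: (bounded_below_regular complete sa (c := `|complex.Im z|)).
- by rewrite normr_gt0.
- by move=> u; exact: nonreal_bounded_below.
- move=> v Dv Av; have := nonreal_bounded_below z^* Dv.
  rewrite Av subrr nrm0; have -> : `|complex.Im z^*| = `|complex.Im z|.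
    by case: (z) => a b /=; rewrite normrN.
  rewrite pmulr_rle0 ?normr_gt0// => v0; apply/eqP.
  by rewrite -(nrm_eq0 dot) eq_le v0 nrm_ge0.
Qed.

Section eigenvalue.
Variable lam : R.
Let B u := A u - lam%:C%C *: u.

Definition ker_shift u := dom A u /\ A u = lam%:C%C *: u.

Lemma ker_shiftZD (a : R) u v : ker_shift u -> ker_shift v -> ker_shift (a%:C%C *: u + v).
Proof.
move=> [Du Au] [Dv Av]; split; first exact: domP.
by rewrite opP// Au Av scalerDr !scalerA mulrC.
Qed.

Lemma ker_shift0 : ker_shift 0.
Proof. by split; [exact: dom0|rewrite op0 scaler0]. Qed.

Lemma ker_shift_closed (x : nat -> H) l (K K' : R) :
  (forall n, dom A (x n)) -> (forall n, nrm (x n - l) <= K * rate n) ->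
  (forall n, nrm (B (x n)) <= K' * rate n) -> ker_shift l.
Proof.
move=> Dx xl Bx.
apply: (self_adjoint_closed sa (x := x) (K := K) (K' := K' + `|lam| * K)) => // n.
have -> : A (x n) - lam%:C%C *: l = B (x n) + lam%:C%C *: (x n - l).
  by rewrite scalerBr subrKA.
apply: le_trans (nrmD _ _ _) _; rewrite nrmZ mulrDl lerD//.
by rewrite -mulrA ler_wpM2l.
Qed.

(** Some [u n] is close to a kernel vector [p], whose finitely many coordinates on [e] are small
    because the sequence is weakly null; this contradicts the norm [1]. *)
Lemma no_singular_sequence (e : seq H) (d : R) (u : nat -> H) :
  orthonormalR dot e -> (forall p, ker_shift p -> oproj dot e p = p) ->
  0 < d -> (forall t : R, 0 < `|t - lam| < 2 * d -> regular dot A t%:C%C) ->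
  (forall n, dom A (u n) /\ nrm (u n) = 1) ->
  (forall a, 0 < a -> \forall n \near \oo, nrm (B (u n)) < a) ->
  (forall g a, 0 < a -> \forall n \near \oo, `|ip (u n) g| < a) -> False.
Proof.
move=> oe he d0 hd Du Bu u0.
(* With this [a], the distance from [u N] to [p] is below [1/4], and the norm of [p] is at most
   [1/2] since each of its coordinates is at most [2 * a]. *)
pose a : R := (4 * ((size e)%:R + 1))^-1.
have s0 : 0 <= (size e)%:R :> R by exact: ler0n.
have a0 : 0 < a by rewrite invr_gt0 mulr_gt0// ltr_wpDl.
have ha : (size e)%:R * a <= 4^-1.
  by rewrite /a invfM mulrCA ler_piMr// ler_pdivrMr ?mul1r ?lerDl ?ltr_wpDl.
have ha4 : a <= 4^-1 by rewrite lef_pV2 ?posrE// ?mulr_gt0 ?ltr_wpDl//; lra.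
have ipu : \forall n \near \oo, forall x, x \in e -> `|ip (u n) x| < a.
  elim: (e) => [|x e' ih]; first by near=> n.
  near=> n => y; rewrite inE => /predU1P[->|].
    by near: n; exact: u0.
  by move: y; near: n.
have [N _ hN] : \forall n \near \oo,
    (forall x, x \in e -> `|ip (u n) x| < a) /\ nrm (B (u n)) < 2 * d * a.
  by apply: filterI => //; apply: Bu; rewrite !mulr_gt0.
have [hx hB] := hN N (leqnn N).
have [Dn n1] := Du N.
have [p [Dp Ap hp]] := isolated_near_eigenspace complete sa d0 hd Dn.
have upa : nrm (u N - p) < a.
  by rewrite -(@ltr_pM2l _ (2 * d)) ?mulr_gt0//; apply: le_lt_trans hp hB.
have pe : nrm p <= (size e)%:R * (2 * a).
  rewrite -{1}(he p (conj Dp Ap)); apply: (nrm_oproj oe) => x xe.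
  have -> : ip p x = ip (u N) x - ip (u N - p) x by rewrite !ipE; ring.
  apply: le_trans (ler_normB _ _) _.
  have := hx x xe; have := ip_norm_le dot (u N - p) x.
  rewrite (orthonormal_nrm oe xe); lra.
have : 1 <= nrm (u N - p) + nrm p by rewrite -n1 -[X in nrm X <= _](subrK p) nrmD.
lra.
Unshelve. all: by end_near. Qed.

(** * Consequences of an a priori estimate modulo a compact term *)

Variables (C : R) (X : H -> H).
Hypothesis C0 : 0 < C.
Hypothesis XB : forall u v, dom A u -> dom A v -> X (u - v) = X u - X v.
Hypothesis estimate : forall u, dom A u -> nrm u <= C * (nrm (B u) + nrm (X u)).
Hypothesis X_compact : forall u : nat -> H,
  (forall n, [/\ dom A (u n), nrm (u n) <= 1 & nrm (B (u n)) <= 1]) ->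
  exists y, forall j, exists2 n, (j <= n)%N & nrm (X (u n) - y) <= rate j.

(* The selection [nu] need not be increasing. *)
Lemma weyl_cauchy (u : nat -> H) :
  (forall n, [/\ dom A (u n), nrm (u n) <= 1 & nrm (B (u n)) <= rate n]) ->
  exists nu : nat -> nat, (forall j, (j <= nu j)%N) /\
    forall i j, nrm (u (nu i) - u (nu j)) <= 2 * C * (rate i + rate j).
Proof.
move=> hu; have [|y hy] := X_compact (u := u).
  by move=> n; have [? ? h] := hu n; split => //; apply: le_trans h (rate_le1 _).
have /choice[nu hnu] : forall j, exists n, (j <= n)%N /\ nrm (X (u n) - y) <= rate j.
  by move=> j; have [n ? ?] := hy j; exists n.
exists nu; split=> [j|i j]; first by have [] := hnu j.
have [[ii hi] [jj hj]] := (hnu i, hnu j).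
have [[Di _ Bi] [Dj _ Bj]] := (hu (nu i), hu (nu j)).
(* Applied to a difference, the estimate has two small [B] terms and two [X] terms close to the same
   [y]. *)
apply: (le_trans (estimate (domB Di Dj))); rewrite /B shiftB// XB//.
have h1 := nrmB dot (B (u (nu i))) (B (u (nu j))).
have h2 : nrm (X (u (nu i)) - X (u (nu j))) <=
    nrm (X (u (nu i)) - y) + nrm (X (u (nu j)) - y).
  have -> : X (u (nu i)) - X (u (nu j)) =
      (X (u (nu i)) - y) - (X (u (nu j)) - y) by rewrite opprB subrKA.
  exact: nrmB.
have := @rate_le R _ _ ii; have := @rate_le R _ _ jj => rj ri.
rewrite -/(B _) -/(B _) [2 * C]mulrC -mulrA ler_pM2l//; lra.
Qed.

(** Otherwise the kernel holds an infinite orthonormal sequence, whose members are pairwise at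
    distance [sqrt 2]; this excludes the Cauchy selection of [weyl_cauchy]. *)
Lemma ker_shift_finite :
  exists2 e, orthonormalR dot e & forall u, ker_shift u -> oproj dot e u = u.
Proof.
have [//|[x [xE x_orth]]] := orthonormal_dichotomy dot ker_shiftZD ker_shift0.
have [|nu [nuj hnu]] := weyl_cauchy (u := x).
  move=> n; have [[Dx Ax] x1] := xE n; split => //; first by rewrite x1.
  by rewrite /B Ax subrr nrm0 ltW// rate_gt0.
have c0 : 0 < (4 * C)^-1 by rewrite invr_gt0 mulr_gt0.
(* The bound [(4 * C)^-1] brings the two selected vectors within distance [1]; [j] exceeds [nu N],
   so that [nu j] and [nu N] differ. *)
have [N hN] := rate_lt c0; pose j := (nu N).+1.
have nlt : (nu N < nu j)%N by apply: leq_trans (nuj j).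
have Nj : (N <= j)%N by apply: leqW.
have := hnu N j; have := hN N (leqnn N); have := hN j Nj.
have := nrm_sqrB dot (x (nu N)) (x (nu j)).
rewrite ipC x_orth// (xE (nu N)).2 (xE (nu j)).2 => hs.
have C4 : (4 * C)^-1 * (4 * C) = 1 by rewrite mulVf// gt_eqF// mulr_gt0.
move=> h1 h2 h3.
have : nrm (x (nu N) - x (nu j)) <= 1 by nra.
by have := nrm_ge0 dot (x (nu N) - x (nu j)); nra.
Qed.

(** Otherwise unit vectors orthogonal to the kernel have images tending to [0]; a selection
    converges to a kernel vector [l], but orthogonality keeps it at distance at least [1] from
    [l]. *)
Lemma bounded_below_off_ker_shift : exists2 c : R, 0 < c &
  forall v, dom A v -> (forall p, ker_shift p -> ip v p = 0) -> c * nrm v <= nrm (B v).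
Proof.
apply: contrapT => h.
have /choice[v hv] : forall n, exists v,
    [/\ dom A v, (forall p, ker_shift p -> ip v p = 0), nrm v = 1 & nrm (B v) <= rate n].
  move=> n; apply: contrapT => hn; apply: h; exists (rate n); first exact: rate_gt0.
  move=> v Dv vk; rewrite leNgt; apply/negP => hlt; apply: hn.
  have v0 : 0 < nrm v.
    by rewrite -(pmulr_rgt0 _ (@rate_gt0 R n)); apply: le_lt_trans hlt; exact: nrm_ge0.
  exists ((nrm v)^-1%:C%C *: v); split.
  - exact: domZ.
  - by move=> p /vk vp; rewrite ipZl vp mulr0.
  - by rewrite nrmZ gtr0_norm ?invr_gt0// mulVf// gt_eqF.
  - rewrite /B shiftZ// nrmZ gtr0_norm ?invr_gt0// mulrC ler_pdivrMr//; exact: ltW.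
have [|nu [nuj hnu]] := weyl_cauchy (u := v).
  by move=> n; have [? _ v1 ?] := hv n; split => //; rewrite v1.
have [l hl] := complete hnu.
have kl : ker_shift l.
  apply: (ker_shift_closed (x := v \o nu) (K' := 1) _ hl) => n /=.
    by have [] := hv (nu n).
  by rewrite mul1r; have [_ _ _ hB] := hv (nu n); apply: le_trans hB (rate_le (nuj n)).
suff : (1 : R) <= 0 by rewrite ler10.
apply: (@le0_rate _ _ (2 * C)) => n; apply: le_trans (hl n).
have [_ /(_ _ kl) vl v1 _] := hv (nu n).
rewrite -(@ler_pXn2r _ 2)// ?nnegrE ?nrm_ge0// nrm_sqrB vl v1.
by have := sqr_ge0 (nrm l); lra.
Qed.

(** [A - t] respects the splitting into the kernel and its complement: it is multiplication by
    [lam - t] on the first and bounded below on the second for [t] close to [lam]. The disjunction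
    serves both the isolation of [lam] and, for a trivial kernel, regularity at [lam] itself. *)
Lemma near_regular : exists2 c : R, 0 < c & forall t : R, `|t - lam| < c ->
  t != lam \/ (forall u, ker_shift u -> u = 0) -> regular dot A t%:C%C.
Proof.
have [c c0 hc] := bounded_below_off_ker_shift.
exists (c / 2); first by rewrite divr_gt0.
move=> t; set s := t - lam => sc ht.
have decomp u : dom A u -> exists p v, [/\ ker_shift p, dom A v, u = p + v,
    forall q, ker_shift q -> ip v q = 0 &
    nrm (A u - t%:C%C *: u) ^+ 2 = nrm (B v - s%:C%C *: v) ^+ 2 + s ^+ 2 * nrm p ^+ 2].
  move=> Du; have [||y hy|p kp up] := projection complete (M := ker_shift) u.
  - exact: ker_shift0.
  - exact: ker_shiftZD.
  - have /choice[x hx] : forall n, exists x, ker_shift x /\ nrm (y - x) < rate n.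
      by move=> n; have [x ? ?] := hy _ (rate_gt0 n); exists x.
    apply: (ker_shift_closed (x := x) (K := 1) (K' := 1)) => n.
    + by have [[]] := hx n.
    + by rewrite mul1r nrmBC ltW//; have [] := hx n.
    + have [[_ Ax] _] := hx n.
      by rewrite /B Ax subrr nrm0 mul1r ltW// rate_gt0.
  exists p, (u - p).
  have Dv : dom A (u - p) by apply: domB => //; exact: kp.1.
  split => //; first by rewrite subrKC.
  have -> : A u - t%:C%C *: u = (B (u - p) - s%:C%C *: (u - p)) - s%:C%C *: p.
    have -> : B (u - p) = B u by rewrite /B shiftB ?kp.2 ?subrr ?subr0//; exact: kp.1.
    rewrite -[RHS]addrA -opprD -scalerDr subrK /B -[RHS]addrA -opprD -scalerDl.
    by rewrite -rmorphD /s subrKC.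
  rewrite nrm_sqrB ipZr nrmZ exprMn real_normK ?num_real//.
  have -> : ip (B (u - p) - s%:C%C *: (u - p)) p = 0.
    rewrite ipDl ipNl ipZl up// (shift_ip sa)//; last exact: kp.1.
    by rewrite kp.2 subrr !ipE; ring.
  by ring.
(* The lower bound [c] loses at most [|s| < c / 2]. *)
have low v : dom A v -> (forall q, ker_shift q -> ip v q = 0) ->
    c / 2 * nrm v <= nrm (B v - s%:C%C *: v).
  move=> Dv vk; have := hc _ Dv vk.
  have : nrm (B v) <= nrm (B v - s%:C%C *: v) + nrm (s%:C%C *: v).
    by rewrite -[X in nrm X <= _](subrK (s%:C%C *: v)) nrmD.
  rewrite nrmZ; have := nrm_ge0 dot v; nra.
have [b b0 hb] : exists2 b : R, 0 < b &
    forall u, dom A u -> b * nrm u <= nrm (A u - t%:C%C *: u).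
  case: ht => [tl|triv].
    have s0 : 0 < `|s| by rewrite normr_gt0 subr_eq0.
    exists `|s| => // u Du; have [p [v [kp Dv uE vk eq]]] := decomp u Du.
    rewrite -(@ler_pXn2r _ 2)// ?nnegrE ?mulr_ge0 ?nrm_ge0// exprMn eq.
    have -> : nrm u ^+ 2 = nrm p ^+ 2 + nrm v ^+ 2.
      by rewrite uE nrm_sqrD ipC vk// mulr0 addr0.
    rewrite real_normK ?num_real// mulrDr addrC lerD2r -[X in X * _](real_normK (num_real s)).
    rewrite -exprMn ler_pXn2r// ?nnegrE ?mulr_ge0 ?nrm_ge0//.
    by apply: le_trans (low _ Dv vk); rewrite ler_wpM2r ?nrm_ge0// ltW.
  exists (c / 2); first by rewrite divr_gt0.
  move=> u Du; have [p [v [kp Dv uE vk eq]]] := decomp u Du.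
  have p0 := triv _ kp; rewrite p0 add0r in uE.
  have c2 : 0 < c / 2 by rewrite divr_gt0.
  have cn w : 0 <= c / 2 * nrm w by exact: mulr_ge0 (ltW c2) (nrm_ge0 _ _).
  rewrite -(@ler_pXn2r _ 2)// ?nnegrE ?nrm_ge0 ?cn// eq uE p0.
  rewrite nrm0 expr0n mulr0 addr0 ler_pXn2r// ?nnegrE ?nrm_ge0 ?cn//.
  exact: low.
apply: (bounded_below_regular complete sa b0 hb) => v Dv Av.
have tt : (t%:C%C)^* = t%:C%C by rewrite -[LHS]/(t%:C%C^*)%C conjc_real.
have := hb v Dv; rewrite Av tt subrr nrm0 pmulr_rle0// => v0; apply/eqP.
by rewrite -(nrm_eq0 dot) eq_le v0 nrm_ge0.
Qed.

End eigenvalue.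
End fredholm.

(** * Completeness of L2 *)

Section riesz_fischer.
Context {disp} {T : measurableType disp} {R : realType}.
Variable mu : {measure set T -> \bar R}.
Implicit Types f g : T -> R.

Lemma Lfun2P f : f \in Lfun mu 2%:E <->
  measurable_fun setT f /\ (\int[mu]_x (f x ^+ 2)%:E < +oo)%E.
Proof.
split=> [lf|[mf lf]].
  split; first by move: lf; rewrite inE => /andP[]; rewrite inE.
  have /integrableP[_] := Lfun2_integrable_sqr lf; apply: le_lt_trans.
  under [leRHS]eq_integral => x _ do rewrite /= ger0_norm ?sqr_ge0//.
  exact: lexx.
rewrite inE; apply/andP; split; rewrite inE//= /finite_norm unlock.
apply: poweR_lty; rewrite (_ : (\int[mu]_x _)%E = (\int[mu]_x (f x ^+ 2)%:E)%E)//.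
apply: eq_integral => x _.
by rewrite /= powR_mulrn ?normr_ge0// real_normK ?num_real.
Qed.

Lemma cvg_of_summable_increments (a : nat -> R) (M : R) :
  (forall n, \sum_(0 <= k < n) `|a k.+1 - a k| <= M) -> cvgn a.
Proof.
move=> aM; pose b k := a k.+1 - a k.
have cb : cvgn (series b).
  apply: normed_cvg; apply: nondecreasing_is_cvgn.
    by apply: nondecreasing_series => n _ _; exact: normr_ge0.
  by exists M => _ [n _ <-]; exact: aM.
have -> : a = fun n => a 0%N + series b n.
  by apply/funext => n; rewrite /series /= telescope_sumr// addrC subrK.
by apply: is_cvgD => //; exact: is_cvg_cst.
Qed.

Lemma geometric_half_le2 n : \sum_(0 <= k < n) (2^-1 : R) ^+ k <= 2.
Proof.
suff -> : \sum_(0 <= k < n) (2^-1 : R) ^+ k = 2 - 2 * 2^-1 ^+ n.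
  by rewrite gerBl mulr_ge0// exprn_ge0.
elim: n => [|n ih]; first by rewrite big_nil expr0; ring.
by rewrite big_nat_recr//= ih exprS; field.
Qed.

(** Riesz-Fischer: a fast subsequence converges almost everywhere, and Fatou's lemma along it
    carries the Cauchy bound to the limit with the same constant. *)
Lemma L2_real_complete (f : nat -> T -> R) (K : R) :
  (forall n, measurable_fun setT (f n)) ->
  (forall m n, \int[mu]_x ((f m x - f n x) ^+ 2)%:E <=
    ((K * (rate m + rate n)) ^+ 2)%:E)%E ->
  exists2 g : T -> R, measurable_fun setT g &
    forall n, (\int[mu]_x ((f n x - g x) ^+ 2)%:E <= ((K * rate n) ^+ 2)%:E)%E.
Proof.
move=> mf hf; pose s k := (2 ^ k)%N.
have rs k : rate (s k) <= (2^-1 : R) ^+ k.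
  rewrite /rate /s exprVn -natrX lef_pV2 ?posrE ?ltr0n ?expn_gt0//.
  by rewrite ler_nat.
(* the weights make the increments summable a.e., by AM-GM:
   [2 |b| <= 2^-k + 2^k b^2] *)
pose t k x : \bar R := (2 ^+ k * (f (s k.+1) x - f (s k) x) ^+ 2)%:E.
have mt k : measurable_fun setT (t k).
  apply/measurable_EFinP; apply: measurable_funM; first exact: measurable_cst.
  by apply: measurable_funX; exact: measurable_funB.
have t0 k x : setT x -> (0 <= t k x)%E.
  by move=> _; rewrite lee_fin mulr_ge0 ?sqr_ge0 ?exprn_ge0.
pose F x : \bar R := (\sum_(k <oo) t k x)%E.
have mF : measurable_fun setT F by apply: ge0_emeasurable_sum => // k x _ _; exact: t0.
have F0 x : (0 <= F x)%E by apply: nneseries_ge0 => k _ _; exact: t0.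
have intF : (\int[mu]_x F x < +oo)%E.
  rewrite integral_nneseries//.
  apply: (@le_lt_trans _ _ (8 * K ^+ 2)%:E); last exact: ltry.
  (* The integral of [t k] is at most [8 * K ^+ 2 / 2 ^+ k.+1], the general term of a series of sum
     [8 * K ^+ 2]. *)
  apply: le_trans (epsilon_trick0 xpredT (_ : 0 <= 8 * K ^+ 2)); last first.
    by rewrite mulr_ge0// sqr_ge0.
  apply: lee_nneseries => [k _ _|k _]; first by apply: integral_ge0 => x; exact: t0.
  under eq_integral do rewrite /t EFinM.
  rewrite ge0_integralZl_EFin ?exprn_ge0//; last 2 first.
    by move=> x _; rewrite lee_fin sqr_ge0.
    by apply/measurable_EFinP/measurable_funX/measurable_funB.
  apply: (@le_trans _ _ ((2 ^+ k)%:E * ((K * (2 * 2^-1 ^+ k)) ^+ 2)%:E)%E).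
    apply: lee_wpmul2l; first by rewrite lee_fin exprn_ge0.
    apply: le_trans (hf _ _) _; rewrite lee_fin !exprMn ler_wpM2l ?sqr_ge0//.
    rewrite -exprMn ler_pXn2r ?nnegrE ?addr_ge0 ?mulr_ge0 ?exprn_ge0 ?(ltW (rate_gt0 _))//.
    have h1 := rs k; have := rs k.+1; rewrite exprS => h2.
    have : 0 <= (2^-1 : R) ^+ k by rewrite exprn_ge0.
    lra.
  rewrite -EFinM lee_fin natrX exprVn (exprS _ k).
  have : (2 : R) ^+ k != 0 by rewrite expf_neq0.
  move: ((2 : R) ^+ k) => y y0.
  have -> : y * (K * (2 * y^-1)) ^+ 2 = 8 * K ^+ 2 / (2 * y).
    by field; rewrite y0.
  exact: lexx.
have aeF : {ae mu, forall x, (F x < +oo)%E}.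
  have iF : mu.-integrable setT F.
    apply/integrableP; split => //; apply: le_lt_trans intF.
    by apply: ge0_le_integral => //; [exact: measurableT_comp|move=> x _; rewrite gee0_abs].
  have := integrable_ae measurableT iF; apply: filterS => x /(_ I).
  by rewrite ge0_fin_numE.
pose G := [set x | (F x < +oo)%E].
have mG : measurable G.
  by rewrite -[G]setTI; exact: emeasurable_fun_infty_o.
have cvG x : G x -> cvgn (fun k => f (s k) x).
  move=> Gx; apply: (@cvg_of_summable_increments _ ((2 + fine (F x)) / 2)) => n.
  have -> : (2 + fine (F x)) / 2 = 2 / 2 + fine (F x) / 2 by rewrite mulrDl.
  have hF : \sum_(0 <= k < n) 2 ^+ k * (f (s k.+1) x - f (s k) x) ^+ 2 <= fine (F x).
    rewrite -lee_fin fineK ?ge0_fin_numE// -sumEFin.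
    by apply: nneseries_lim_ge => k _ _; exact: t0.
  have hg := geometric_half_le2 n.
  apply: (@le_trans _ _ (\sum_(0 <= k < n) (2^-1 ^+ k / 2 +
     2 ^+ k * (f (s k.+1) x - f (s k) x) ^+ 2 / 2))).
    apply: ler_sum => k _; rewrite exprVn.
    have y0 : 0 < (2 : R) ^+ k by rewrite exprn_gt0.
    set b := f _ x - f _ x; rewrite -mulrDl ler_pdivlMr//.
    rewrite -(@ler_pM2r _ (2 ^+ k))// mulrDl mulVf ?gt_eqF//.
    rewrite -[b ^+ 2]real_normK ?num_real//.
    by have := sqr_ge0 (1 - 2 ^+ k * `|b|); nra.
  by rewrite big_split /= -!mulr_suml; lra.
(* Cutting off by the conull set [G] gives convergence at every point, hence a measurable limit. *)
pose h k x := f (s k) x * \1_G x.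
have mh k : measurable_fun setT (h k).
  by apply: measurable_funM => //; exact: measurable_indic.
have hG k x : G x -> h k x = f (s k) x.
  by move=> Gx; rewrite /h indicE mem_set// mulr1.
have ch x : cvgn (h ^~ x).
  have [Gx|nGx] := pselect (G x).
    rewrite (_ : h ^~ x = fun k => f (s k) x); first exact: cvG.
    by apply/funext => k; exact: hG.
  rewrite (_ : h ^~ x = fun=> 0); first exact: is_cvg_cst.
  by apply/funext => k; rewrite /h indicE memNset// mulr0.
pose g x := limn (h ^~ x).
have mg : measurable_fun setT g by apply: (measurable_fun_cvg mh) => x _; exact: ch.
exists g => // n.
have mfh k : measurable_fun setT (fun x => ((f n x - h k x) ^+ 2)%:E).
  by apply/measurable_EFinP/measurable_funX/measurable_funB.
have lime x : limn_einf (fun k => ((f n x - h k x) ^+ 2)%:E) = ((f n x - g x) ^+ 2)%:E.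
  have [|-> _] := @cvg_limn_einf_sup R (fun k => ((f n x - h k x) ^+ 2)%:E)
    ((f n x - g x) ^+ 2)%:E; last by [].
  apply/cvg_EFin; first by apply: nearW.
  have cB : (fun k => f n x - h k x) @ \oo --> f n x - g x.
    by apply: cvgB; [exact: cvg_cst|exact: ch].
  rewrite (_ : fine \o _ = fun k => (f n x - h k x) * (f n x - h k x)).
    by rewrite expr2; exact: cvgM.
  by apply/funext => k /=; rewrite expr2.
under eq_integral do rewrite -lime.
apply: le_trans (fatou mu measurableT mfh _) _.
  by move=> k x _; rewrite lee_fin sqr_ge0.
pose b k : \bar R := ((K * (rate n + rate (s k))) ^+ 2)%:E.
have cb : b @ \oo --> ((K * rate n) ^+ 2)%:E.
  apply/cvg_EFin; first by apply: nearW.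
  have crs : (fun k => rate (s k) : R) @ \oo --> (0 : R).
    apply: (squeeze_cvgr (f := fun=> 0) (h := fun k => (2^-1 : R) ^+ k)).
    - by apply: nearW => k; rewrite rs ltW// rate_gt0.
    - exact: cvg_cst.
    - by apply: cvg_expr; rewrite ger0_norm// invf_lt1// ltr1n.
  have cK : (fun k => K * (rate n + rate (s k))) @ \oo --> K * (rate n + 0).
    by apply: cvgMr; apply: cvgD => //; exact: cvg_cst.
  rewrite addr0 in cK.
  rewrite (_ : fine \o _ = fun k => K * (rate n + rate (s k)) * (K * (rate n + rate (s k)))).
    by rewrite expr2; exact: cvgM.
  by apply/funext => k /=; rewrite expr2.
have bE k : (\int[mu]_x ((f n x - h k x) ^+ 2)%:E <= b k)%E.
  rewrite (_ : (\int[mu]_x _)%E = (\int[mu]_x ((f n x - f (s k) x) ^+ 2)%:E)%E).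
    exact: hf.
  apply: ge0_ae_eq_integral => //.
  - by apply/measurable_EFinP/measurable_funX/measurable_funB.
  - by move=> x _; rewrite lee_fin sqr_ge0.
  - by move=> x _; rewrite lee_fin sqr_ge0.
  - by apply: filterS aeF => x Fx _; rewrite hG.
rewrite limn_einf_lim -(cvg_lim _ cb)//.
apply: lee_lim; [exact: is_cvg_einfs|by apply/cvg_ex; eexists; exact: cb|].
apply: nearW => k; apply: le_trans (bE k).
by apply: ereal_inf_lbound; exists k => /=.
Qed.

End riesz_fischer.

(** * Complex-valued square integrable functions *)

Section complex_L2.
Context {disp} {T : measurableType disp} {R : realType}.
Variable mu : {measure set T -> \bar R}.
Implicit Types (u v w : L2 mu) (f g : T -> R[i]).

Definition L2_form : {dot (L2 mu) for Num.conj} := L2_dot.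
Local Notation nrm := (real_nrm L2_form).

(** The norm of [L2 mu] has values in [R[i]]; this identity moves estimates to [R]. *)
Lemma L2_norm_nrm u : `|u| = (nrm u)%:C%C.
Proof.
rewrite L2_normE.
have -> : L2_dot u u = ((nrm u) ^+ 2)%:C%C by rewrite -ipxx -ip_dot.
by rewrite rmorphXn sqrCK// ler0c nrm_ge0.
Qed.

Lemma cLfun2_measurable f : f \in @cLfun2 _ _ _ mu ->
  measurable_fun setT (fun x => complex.Re (f x)) /\
  measurable_fun setT (fun x => complex.Im (f x)).
Proof. by move=> /andP[/Lfun2P[? _] /Lfun2P[]]. Qed.

Definition abs2 (z : R[i]) : R := complex.Re z ^+ 2 + complex.Im z ^+ 2.

Lemma abs2_ge0 z : 0 <= abs2 z.
Proof. by rewrite addr_ge0 ?sqr_ge0. Qed.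

Lemma measurable_abs2 f : f \in @cLfun2 _ _ _ mu ->
  measurable_fun setT (fun x => abs2 (f x)).
Proof.
move=> /cLfun2_measurable[rf i_f].
by apply: measurable_funD; exact: measurable_funX.
Qed.

Lemma L2_nrm_integral u : (\int[mu]_x (abs2 (u x))%:E = (nrm u ^+ 2)%:E)%E.
Proof.
rewrite -ipxx /real_ip.
have [ir _] := cintegrable_dot (L2_funP u) (L2_funP u).
have -> : complex.Re (L2_form u u) = fine (\int[mu]_x (complex.Re (u x * (u x)^*))%:E)%E by [].
rewrite fineK; last exact: integrable_fin_num.
apply: eq_integral => x _; congr EFin; rewrite /abs2.
by case: (u x) => a b /=; rewrite mulrN opprK !expr2.
Qed.

Lemma L2_nrm_ae u f : f \in @cLfun2 _ _ _ mu ->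
  (\forall x \ae mu, u x = f x) ->
  (\int[mu]_x (abs2 (f x))%:E = (nrm u ^+ 2)%:E)%E.
Proof.
move=> lf uf; rewrite -L2_nrm_integral; apply: ge0_ae_eq_integral => //.
- exact/measurable_EFinP/measurable_abs2.
- exact/measurable_EFinP/measurable_abs2/L2_funP.
- by move=> x _; rewrite lee_fin abs2_ge0.
- by move=> x _; rewrite lee_fin abs2_ge0.
- by apply: filterS uf => x ->.
Qed.

Lemma cLfun2P f : f \in @cLfun2 _ _ _ mu <->
  [/\ measurable_fun setT (fun x => complex.Re (f x)),
      measurable_fun setT (fun x => complex.Im (f x)) &
      (\int[mu]_x (abs2 (f x))%:E < +oo)%E].
Proof.
split=> [lf|[mr mi fi]].
  have [? ?] := cLfun2_measurable lf; split => //.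
  by rewrite (L2_nrm_ae lf (L2_ofE lf)) ltry.
apply/andP; split; apply/Lfun2P; split => //; apply: le_lt_trans fi;
  apply: ge0_le_integral => //.
- by move=> x _; rewrite lee_fin sqr_ge0.
- exact/measurable_EFinP/measurable_funX.
- by apply/measurable_EFinP/measurable_funD; exact: measurable_funX.
- by move=> x _; rewrite lee_fin lerDl sqr_ge0.
- by move=> x _; rewrite lee_fin sqr_ge0.
- exact/measurable_EFinP/measurable_funX.
- by apply/measurable_EFinP/measurable_funD; exact: measurable_funX.
- by move=> x _; rewrite lee_fin lerDr sqr_ge0.
Qed.

Lemma L2_funN u : \forall x \ae mu, (- u : L2 mu) x = - u x.
Proof. by rewrite -scaleN1r; apply: filterS (L2_funZ (-1) u) => x ->; rewrite mulN1r. Qed.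

Lemma L2_funB u v : \forall x \ae mu, (u - v : L2 mu) x = u x - v x.
Proof. by apply: filterS2 (L2_funD u (- v)) (L2_funN v) => x -> ->. Qed.

Lemma cLfun2B f g : f \in @cLfun2 _ _ _ mu -> g \in @cLfun2 _ _ _ mu ->
  (fun x => f x - g x) \in @cLfun2 _ _ _ mu.
Proof.
move=> lf lg; rewrite (_ : (fun x => _) = fun x => f x + (-1) * g x).
  by apply: cLfun2D => //; exact: cLfun2Z.
by apply/funext => x; rewrite mulN1r.
Qed.

Lemma L2_complete_seq (K : R) (u : nat -> L2 mu) :
  (forall m n, nrm (u m - u n) <= K * (rate m + rate n)) ->
  exists l, forall n, nrm (u n - l) <= K * rate n.
Proof.
move=> hu.
have K0 : 0 <= K.
  have := hu 0%N 0%N; have := @rate_gt0 R 0; rewrite subrr nrm0; nra.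
have Luu m n := L2_nrm_ae (cLfun2B (L2_funP (u m)) (L2_funP (u n))) (L2_funB (u m) (u n)).
have bound m n : (\int[mu]_x (abs2 (u m x - u n x))%:E <= ((K * (rate m + rate n)) ^+ 2)%:E)%E.
  rewrite Luu lee_fin ler_pXn2r ?nnegrE ?nrm_ge0//.
  by rewrite mulr_ge0// addr_ge0// ltW// rate_gt0.
have mm m n := measurable_abs2 (cLfun2B (L2_funP (u m)) (L2_funP (u n))).
have ReB (z z' : R[i]) : complex.Re (z - z') = complex.Re z - complex.Re z'.
  by case: z z' => ? ? [].
have ImB (z z' : R[i]) : complex.Im (z - z') = complex.Im z - complex.Im z'.
  by case: z z' => ? ? [].
have [mr mi] : (forall n, measurable_fun setT (fun x => complex.Re (u n x))) /\
    (forall n, measurable_fun setT (fun x => complex.Im (u n x))).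
  by split => n; have [] := cLfun2_measurable (L2_funP (u n)).
have [||g mg hg] := @L2_real_complete _ _ _ mu (fun n x => complex.Re (u n x)) K.
- exact: mr.
- move=> m n; apply: le_trans (bound m n); apply: ge0_le_integral => //.
  + by move=> x _; rewrite lee_fin sqr_ge0.
  + by apply/measurable_EFinP/measurable_funX/measurable_funB.
  + exact/measurable_EFinP.
  + by move=> x _; rewrite lee_fin /abs2 ReB lerDl sqr_ge0.
have [||h mh hh] := @L2_real_complete _ _ _ mu (fun n x => complex.Im (u n x)) K.
- exact: mi.
- move=> m n; apply: le_trans (bound m n); apply: ge0_le_integral => //.
  + by move=> x _; rewrite lee_fin sqr_ge0.
  + by apply/measurable_EFinP/measurable_funX/measurable_funB.
  + exact/measurable_EFinP.
  + by move=> x _; rewrite lee_fin /abs2 ImB lerDr sqr_ge0.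
pose f x := Complex (g x) (h x).
(* Adding the squared bounds for the real and imaginary parts costs a factor [2], absorbed in the
   constant [2 * K]. *)
have ufn n : (\int[mu]_x (abs2 (u n x - f x))%:E <= ((2 * K * rate n) ^+ 2)%:E)%E.
  under eq_integral do rewrite /abs2 ReB ImB /= EFinD.
  rewrite ge0_integralD//.
  - apply: le_trans (leeD (hg n) (hh n)) _.
    by rewrite -EFinD lee_fin -mulrA exprMn; have := sqr_ge0 (K * rate n); lra.
  - by move=> x _; rewrite lee_fin sqr_ge0.
  - by apply/measurable_EFinP/measurable_funX/measurable_funB.
  - by move=> x _; rewrite lee_fin sqr_ge0.
  - by apply/measurable_EFinP/measurable_funX/measurable_funB.
have uf n : (fun x => u n x - f x) \in @cLfun2 _ _ _ mu.
  apply/cLfun2P; split; last exact: le_lt_trans (ufn n) (ltry _).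
    by under eq_fun do rewrite ReB; exact: measurable_funB.
  by under eq_fun do rewrite ImB; exact: measurable_funB.
have lf : f \in @cLfun2 _ _ _ mu.
  rewrite (_ : f = fun x => u 0%N x - (u 0%N x - f x)).
    by apply: cLfun2B => //; exact: L2_funP.
  by apply/funext => x; rewrite subKr.
pose l : L2 mu := L2_of f; exists l => n.
have ul m : nrm (u m - l) <= 2 * K * rate m.
  rewrite -(@ler_pXn2r _ 2)// ?nnegrE ?nrm_ge0 ?mulr_ge0 ?(ltW (rate_gt0 _))//.
  rewrite -lee_fin -(L2_nrm_ae (uf m))//.
  by apply: filterS2 (L2_funB (u m) l) (L2_ofE lf) => x -> ->.
(* The constant returns to [K] by passing through [u m] and letting [m] tend to infinity. *)
rewrite -subr_le0; apply: (@le0_rate _ _ (K + 2 * K)) => m.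
have -> : u n - l = (u n - u m) + (u m - l) by rewrite subrKA.
have := nrmD L2_form (u n - u m) (u m - l); have := hu n m; have := ul m.
move: (nrm (u n - u m + (u m - l))) (nrm (u n - u m)) (nrm (u m - l)).
by move: (rate n) (rate m) => r s a b c; lra.
Qed.

Lemma L2_complete : rate_complete L2_form.
Proof. by move=> K u; exact: L2_complete_seq. Qed.

End complex_L2.

(** * Operators on L2 *)

Section L2_operators.
Context {disp} {T : measurableType disp} {R : realType}.
Variable mu : {measure set T -> \bar R}.
Local Notation form := (L2_form mu).
Local Notation nrm := (real_nrm form).
Local Notation ip := (real_ip form).
Variable A : operator (L2 mu).

Lemma self_adjointP : self_adjoint L2_dot A -> ip_self_adjoint form A.
Proof.
move=> [_ E].
split=> [u v Du Dv|v w h].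
  have : graph A (v, A v) by [].
  by rewrite E => /(_ u Du) /= h; rewrite /real_ip [form _ _]h.
have : graph A (v, w).
  (* Testing on every [z *: u], again in the domain, recovers the full complex identity. *)
  rewrite E => u Du /=; apply: (@dot_ip _ _ form) => z.
  by rewrite -(opZ z Du) h//; exact: domZ.
by move=> [/= Dv ->].
Qed.

Lemma resolventE z u : {in dom A &, injective (fun w => A w - z *: w)} ->
  dom A u -> resolvent A z (A u - z *: u) = u.
Proof.
move=> inj Du.
have [Dr Er] : dom A (resolvent A z (A u - z *: u)) /\
    A (resolvent A z (A u - z *: u)) - z *: resolvent A z (A u - z *: u) = A u - z *: u.
  by apply: (@xgetPex _ 0 [set x | dom A x /\ A x - z *: x = A u - z *: u]); exists u.
by apply: inj; rewrite ?inE.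
Qed.

Lemma bounded_below_injective z (c : R) : 0 < c ->
  (forall u, dom A u -> c * nrm u <= nrm (A u - z *: u)) ->
  {in dom A &, injective (fun w => A w - z *: w)}.
Proof.
move=> c0 hc u v; rewrite !inE => Du Dv uv; apply/subr0_eq/eqP.
have E : A (u - v) - z *: (u - v) = 0 by rewrite (shiftB z Du Dv) uv subrr.
have := hc _ (domB Du Dv); rewrite E nrm0 (pmulr_rle0 _ c0) => h.
by rewrite -(nrm_eq0 form) eq_le h nrm_ge0.
Qed.

Lemma resolvent_setP z : resolvent_set A z <-> regular form A z.
Proof.
split=> [[[_ inj surj] [M hM]]|[[c c0 hc] surj]].
- split; last by move=> w; have [u Du <-] := surj w I; exists u.
  (* The constant [M] is an arbitrary complex number; its real part bounds the norms, and [+ 1]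
     keeps the inverse positive. *)
  exists (`|complex.Re M| + 1)^-1; first by rewrite invr_gt0 ltr_wpDl.
  move=> u Du; rewrite mulrC ler_pdivrMr ?ltr_wpDl//.
  rewrite -{1}(resolventE inj Du).
  have := hM (A u - z *: u); rewrite !L2_norm_nrm lecE => /andP[_].
  have -> (a : R[i]) (b : R) : complex.Re (a * b%:C%C) = complex.Re a * b.
    by case: a => ? ? /=; rewrite mulr0 subr0.
  rewrite /= mulrC => /le_trans; apply.
  rewrite ler_wpM2l ?nrm_ge0//.
  by have := ler_norm (complex.Re M); lra.
- have inj := bounded_below_injective c0 hc.
  split; first by split => // w _; have [u Du <-] := surj w; exists u.
  exists (c^-1)%:C%C => w; have [u Du <-] := surj w.
  rewrite (resolventE inj Du) !L2_norm_nrm -rmorphM lecR mulrC.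
  by rewrite ler_pdivlMr// mulrC; exact: hc.
Qed.

End L2_operators.

(** * Functions on 'rV[R]_d *)

Section borel_rV.
Context {R : realType} {d : nat}.
Implicit Types (U : set 'rV[R]_d) (f : 'rV[R]_d -> R).

(** The sigma-algebra is generated by the coordinates, so an open set is written as a countable
    union of boxes with rational centres and half-widths given by [rate]. *)
Lemma open_measurable_rV U : open U -> measurable U.
Proof.
move=> oU.
pose box (p : 'rV[rat]_d * nat) : set 'rV[R]_d :=
  [set y | forall i, `|ratr (p.1 ord0 i) - y ord0 i| < rate p.2].
have mbox p : measurable (box p).
  rewrite (_ : box p = \bigcap_(i in [set: 'I_d])
      (fun x : 'rV[R]_d => x ord0 i : measurableTypeR R) @^-1`
        [set t | `|ratr (p.1 ord0 i) - t| < rate p.2]).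
    apply: fin_bigcap_measurable => [|i _]; first exact: finite_finset.
    rewrite -[X in measurable X]setTI; apply: measurable_rV_coord => //.
    rewrite (_ : [set t | _] = ball (ratr (p.1 ord0 i) : R) (rate p.2)) //.
    exact: measurable_ball.
  by apply/seteqP; split => x /= h i => [_|]; exact: h.
have -> : U = \bigcup_(p : 'rV[rat]_d * nat) (if `[< box p `<=` U >] then box p else set0).
  apply/seteqP; split => [x Ux|x [p _]]; last by case: asboolP => // + ?; apply.
  have : nbhs x U by apply: open_nbhs_nbhs.
  move=> /nbhs_ballP[e /= e0 eU].
  have [N hN] := rate_lt (divr_gt0 e0 (ltr0Sn R 1)).
  have rN := @rate_gt0 R N.
  have /choice[q hq] : forall i : 'I_d, exists q : rat,
      ratr q \in `]x ord0 i - rate N, x ord0 i + rate N[.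
    by move=> i; apply: rat_in_itvoo; lra.
  exists (\row_i q i, N) => //.
  have -> : `[< box (\row_i q i, N) `<=` U >].
    apply/asboolP => y hy; apply: eU; split => // i j; rewrite (ord1 i).
    have := hy j; rewrite /= mxE ltr_norml => /andP[h3 h4].
    have := hq j; rewrite in_itv /= => /andP[h1 h2].
    rewrite /ball /= ltr_norml.
    by have h5 := hN N (leqnn N); apply/andP; split; lra.
  move=> i /=; rewrite mxE; have := hq i; rewrite in_itv /= => /andP[h1 h2].
  by rewrite ltr_norml; apply/andP; split; lra.
apply: countable_bigcupT_measurable => [|p]; first exact: countableP.
by case: ifP.
Qed.

Lemma continuous_measurable_rV f : continuous f -> measurable_fun setT f.
Proof.
move=> /continuousP cf; apply: (measurability _ (RGenOpens.measurableE R)).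
move=> _ [_ [a [b ->] <-]]; rewrite setTI; apply: open_measurable_rV.
exact/cf/interval_open.
Qed.

Lemma continuous_enorm : continuous (@enorm R d).
Proof.
move=> x; apply: continuous_comp; last exact: sqrt_continuous.
have h (s : seq 'I_d) : continuous (fun y : 'rV[R]_d => \sum_(i <- s) y ord0 i ^+ 2).
  elim: s => [|i s ih] y.
    rewrite (_ : (fun y => _) = cst 0); first exact: cst_continuous.
    by apply/funext => z; rewrite big_nil.
  rewrite (_ : (fun y => _) = (fun z : 'rV[R]_d => z ord0 i * z ord0 i) \+
     (fun z : 'rV[R]_d => \sum_(j <- s) z ord0 j ^+ 2)).
    by apply: continuousD; [apply: continuousM; exact: coord_continuous|exact: ih].
  by apply/funext => z; rewrite big_cons expr2.
exact: h.
Qed.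

Lemma norm_le_enorm (x : 'rV[R]_d) : `|x| <= enorm x.
Proof.
rewrite [leLHS]/Num.norm /= mx_normrE; apply: bigmax_le => [|[i j] _ /=].
  exact: sqrtr_ge0.
rewrite (ord1 i) -sqrtr_sqr ler_sqrt; last by apply: sumr_ge0 => k _; exact: sqr_ge0.
by rewrite (bigD1 j)//= lerDl; apply: sumr_ge0 => k _; exact: sqr_ge0.
Qed.

Lemma measurable_enorm : measurable_fun setT (@enorm R d).
Proof. by apply: continuous_measurable_rV => x; exact: continuous_enorm. Qed.

Lemma measurable_enorm_le (r : R) : measurable [set x : 'rV[R]_d | enorm x <= r].
Proof.
rewrite -[X in measurable X]setTI (_ : [set x | _] = @enorm R d @^-1` `]-oo, r]).
  exact: measurable_enorm.
by apply/seteqP; split => x /=; rewrite in_itv.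
Qed.

Lemma compact_enorm_le (r : R) : compact [set x : 'rV[R]_d | enorm x <= r].
Proof.
apply: bounded_closed_compact.
  exists r; split; first exact: num_real.
  by move=> s rs x /= xr; apply: le_trans (norm_le_enorm x) _; apply: le_trans xr (ltW rs).
rewrite (_ : [set x | _] = @enorm R d @^-1` [set y | y <= r])//.
by apply: closed_comp (@closed_le _ r) => x _; exact: continuous_enorm.
Qed.

Local Notation L := (L2 (@lebesgue_rV R d)).

(** The support is defined locally; compactness of the closed ball leaves finitely many
    neighbourhoods, whose null sets can be united. *)
Lemma ess_supp_ae (u : L) (r : R) :
  ess_supp u `<=` ~` [set x | enorm x <= r] ->
  \forall x \ae @lebesgue_rV R d, enorm x <= r -> u x = 0.
Proof.
move=> hu.
have /choice[V hV] : forall x, exists V, enorm x <= r ->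
    [/\ open V, V x & \forall y \ae @lebesgue_rV R d, V y -> u y = 0].
  move=> x; have [xr|] := boolP (enorm x <= r); last by exists set0.
  have : ~ ess_supp u x by move=> /hu; apply.
  rewrite /ess_supp /= => /existsNP[U /not_implyP[xU /contrapT hU]].
  move: xU; rewrite nbhsE => -[V [oV Vx] VU]; exists V => _; split => //.
  by apply: filterS hU => y Uy /VU.
have := @compact_enorm_le r; rewrite compact_cover.
move=> /(_ _ [set x | enorm x <= r] V) [].
- by move=> x /hV[].
- by move=> x xr; exists x => //; have [] := hV x xr.
move=> D' D'r cov.
have h (s : seq 'rV[R]_d) : {subset s <= D'} ->
    \forall y \ae @lebesgue_rV R d, forall x, x \in s -> V x y -> u y = 0.
  elim: s => [|x s ih] sD; first by apply: aeW.
  have xr : enorm x <= r by have := D'r x (sD x (mem_head _ _)); rewrite inE.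
  have [_ _ hx] := hV x xr.
  have := ih (fun z zs => sD z (mem_behead (s := x :: s) zs)).
  apply: filterS2 hx => y hx hs z; rewrite inE => /predU1P[->|]; [exact: hx|exact: hs].
have := h (enum_fset D') (fun x xD => xD); apply: filterS => y hy yr.
by have [x xD Vxy] := cov y yr; exact: (hy x).
Qed.

(** The gap between [r] and [s] makes the open ball of radius [s] a neighbourhood of each point of
    the closed ball of radius [r]. *)
Lemma ae_ess_supp (u : L) (r s : R) : r < s ->
  (\forall x \ae @lebesgue_rV R d, enorm x < s -> u x = 0) ->
  ess_supp u `<=` ~` [set x | enorm x <= r].
Proof.
move=> rs hu x xu /= xr; apply: (xu [set y | enorm y < s]) => //.
have : nbhs (enorm x) [set t : R | t < s].
  by apply: open_nbhs_nbhs; split; [exact: open_lt|exact: le_lt_trans xr rs].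
exact: continuous_enorm.
Qed.

End borel_rV.

Lemma nrm_le_ae {disp} {T : measurableType disp} {R : realType}
    (mu : {measure set T -> \bar R}) (u v : L2 mu) (M : R) : 0 <= M ->
  (\forall x \ae mu, abs2 (u x) <= M ^+ 2 * abs2 (v x)) ->
  real_nrm (L2_form mu) u <= M * real_nrm (L2_form mu) v.
Proof.
move=> M0 uv; rewrite -(@ler_pXn2r _ 2)// ?nnegrE ?mulr_ge0 ?nrm_ge0//.
rewrite exprMn -lee_fin (EFinM (M ^+ 2)) -!L2_nrm_integral.
have mv := measurable_abs2 (L2_funP v).
rewrite -ge0_integralZl_EFin ?sqr_ge0//; last 2 first.
- by move=> x _; rewrite lee_fin abs2_ge0.
- exact/measurable_EFinP.
apply: ae_ge0_le_integral => //.
- by move=> x _; rewrite lee_fin abs2_ge0.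
- exact/measurable_EFinP/measurable_abs2/L2_funP.
- by move=> x _; rewrite -EFinM lee_fin mulr_ge0 ?abs2_ge0 ?sqr_ge0.
- by apply/measurable_EFinP/measurable_funM.
- by apply: filterS uv => x h _; rewrite -EFinM lee_fin.
Qed.

Lemma abs2Z {R : realType} (a : R) (z : R[i]) : abs2 (a%:C%C * z) = a ^+ 2 * abs2 z.
Proof. by case: z => x y; rewrite /abs2 /= !mul0r subr0 addr0; ring. Qed.

(** * Multiplication by bounded functions *)

Section multiplication.
Context {R : realType} {d : nat}.
Local Notation leb := (@lebesgue_rV R d).
Local Notation L := (L2 leb).
Local Notation nrm := (real_nrm (L2_form leb)).
Local Notation ip := (real_ip (L2_form leb)).
Implicit Types (f : 'rV[R]_d -> R) (u v : L).

Section bounded_multiplier.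
Variables (f : 'rV[R]_d -> R) (M : R).
Hypothesis mf : measurable_fun setT f.
Hypothesis fM : forall x, `|f x| <= M.

Let M0 : 0 <= M. Proof. exact: le_trans (fM 0). Qed.

Let f2M x : f x ^+ 2 <= M ^+ 2.
Proof. by rewrite -real_normK ?num_real// ler_pXn2r ?nnegrE. Qed.

Lemma mul_cLfun2 u : (fun x => (f x)%:C%C * u x) \in @cLfun2 _ _ _ leb.
Proof.
have [mr mi] := cLfun2_measurable (L2_funP u).
apply/cLfun2P; split.
- rewrite (_ : (fun x => _) = (fun x => f x * complex.Re (u x))).
    exact: measurable_funM.
  by apply/funext => x; case: (u x) => a b /=; rewrite mul0r subr0.
- rewrite (_ : (fun x => _) = (fun x => f x * complex.Im (u x))).
    exact: measurable_funM.
  by apply/funext => x; case: (u x) => a b /=; rewrite mul0r addr0.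
- have m2 := measurable_abs2 (L2_funP u).
  apply: (@le_lt_trans _ _ (\int[leb]_x ((M ^+ 2)%:E * (abs2 (u x))%:E))%E).
    apply: ge0_le_integral => //.
    + by move=> x _; rewrite lee_fin abs2_ge0.
    + under eq_fun do rewrite abs2Z.
      by apply/measurable_EFinP/measurable_funM => //; exact: measurable_funX.
    + by apply/measurable_EFinP/measurable_funM.
    + by move=> x _; rewrite abs2Z -EFinM lee_fin ler_wpM2r ?abs2_ge0.
  rewrite ge0_integralZl_EFin ?sqr_ge0//; last 2 first.
  + by move=> x _; rewrite lee_fin abs2_ge0.
  + exact/measurable_EFinP.
  by rewrite L2_nrm_integral -EFinM ltry.
Qed.

Lemma mul_opE u : \forall x \ae leb, mul_op f u x = (f x)%:C%C * u x.
Proof. exact/L2_ofE/mul_cLfun2. Qed.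

Lemma nrm_mul_op u : nrm (mul_op f u) <= M * nrm u.
Proof.
apply: nrm_le_ae => //; apply: filterS (mul_opE u) => x ->.
by rewrite abs2Z ler_wpM2r ?abs2_ge0.
Qed.

Lemma mul_opD u v : mul_op f (u + v) = mul_op f u + mul_op f v.
Proof.
apply: L2P; near=> x.
rewrite (near (mul_opE (u + v)) x)// (near (L2_funD (mul_op f u) (mul_op f v)) x)//.
rewrite (near (L2_funD u v) x)// (near (mul_opE u) x)// (near (mul_opE v) x)//.
by rewrite mulrDr.
Unshelve. all: by end_near. Qed.

Lemma mul_opZ (a : R[i]) u : mul_op f (a *: u) = a *: mul_op f u.
Proof.
apply: L2P; near=> x.
rewrite (near (mul_opE (a *: u)) x)// (near (L2_funZ a (mul_op f u)) x)//.
by rewrite (near (L2_funZ a u) x)// (near (mul_opE u) x)// mulrCA.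
Unshelve. all: by end_near. Qed.

Lemma mul_opB u v : mul_op f (u - v) = mul_op f u - mul_op f v.
Proof. by rewrite mul_opD -scaleN1r mul_opZ scaleN1r. Qed.

End bounded_multiplier.

Lemma indic_norm_le1 (B : set 'rV[R]_d) x : `|\1_B x : R| <= 1.
Proof. by rewrite indicE; case: (x \in B); rewrite ?normr1 ?normr0 ?ler01. Qed.

Lemma nrm_mul_op_indic f (M : R) (B : set 'rV[R]_d) u :
  measurable_fun setT f -> (forall x, `|f x| <= M) -> measurable B ->
  (forall x, ~ B x -> f x = 0) -> nrm (mul_op f u) <= M * nrm (mul_op \1_B u).
Proof.
move=> mf fM mB fB.
apply: nrm_le_ae; first exact: le_trans (fM 0).
have mI := mul_opE (measurable_indic mB : measurable_fun setT (\1_B : _ -> R)) (@indic_norm_le1 B) u.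
apply: filterS2 (mul_opE mf fM u) mI => x -> ->; rewrite !abs2Z mulrA.
rewrite ler_wpM2r ?abs2_ge0//; have [Bx|nBx] := pselect (B x).
  rewrite indicE mem_set// expr1n mulr1 -real_normK ?num_real//.
  by rewrite ler_pXn2r ?nnegrE//; exact: le_trans (fM x).
by rewrite fB// expr0n mulr_ge0 ?sqr_ge0.
Qed.

(** The pairing with [u k] sees only the part of [g] outside the ball of radius [k], whose norm
    tends to [0] by dominated convergence. *)
Lemma escaping_weakly_null (u : nat -> L) :
  (forall k, nrm (u k) = 1) ->
  (forall k, \forall x \ae leb, enorm x <= k%:R -> u k x = 0) ->
  forall (g : L) (a : R), 0 < a -> \forall k \near \oo, `|ip (u k) g| < a.
Proof.
move=> u1 u0 g a a0.
pose O k := ~` [set x : 'rV[R]_d | enorm x <= k%:R].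
have mO k : measurable (O k) by apply: measurableC; exact: measurable_enorm_le.
have mi k : measurable_fun setT (\1_(O k) : 'rV[R]_d -> R) by exact: measurable_indic.
pose h k x := (abs2 ((\1_(O k) x)%:C%C * g x))%:E.
have bound k : `|ip (u k) g| <= nrm (mul_op \1_(O k) g).
  have -> : ip (u k) g = ip (u k) (mul_op \1_(O k) g).
    rewrite /real_ip; congr complex.Re.
    apply: eq_ae_cintegral; try by apply: cintegrable_dot; exact: L2_funP.
    apply: filterS2 (u0 k) (mul_opE (mi k) (@indic_norm_le1 (O k)) g) => x hx ->.
    have [xk|xk] := boolP (enorm x <= k%:R); first by rewrite hx// !mul0r.
    by rewrite indicE mem_set ?mul1r//; exact/negP.
  by apply: le_trans (ip_norm_le _ _ _) _; rewrite u1 mul1r.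
have mg := measurable_abs2 (L2_funP g).
have cvg0 : (fun k => (\int[leb]_x h k x)%E) @ \oo --> (\int[leb]_x (cst 0 x))%E.
  apply: (@dominated_cvg _ _ _ leb setT measurableT h (cst 0%E) (fun x => (abs2 (g x))%:E)).
  - by move=> k; exact/measurable_EFinP/measurable_abs2/mul_cLfun2/indic_norm_le1.
  - move=> x _; apply: cvg_near_cst.
    (* From this index on, [x] is inside the ball of radius [k] and [h k x] vanishes. *)
    exists (Num.truncn (enorm x)).+1 => // k /= xk.
    rewrite /h indicE memNset ?mul0r /abs2 /= ?expr0n ?addr0//.
    move=> /=; apply; apply/ltW/(lt_le_trans (truncnS_gt _)).
    by rewrite ler_nat.
  - by [].
  - apply/integrableP; split; first exact/measurable_EFinP.
    under eq_integral do rewrite gee0_abs ?lee_fin ?abs2_ge0//.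
    by rewrite L2_nrm_integral ltry.
  - move=> k x _; rewrite gee0_abs ?lee_fin ?abs2_ge0// /h abs2Z.
    apply: ler_piMl; first exact: abs2_ge0.
    by rewrite indicE; case: (x \in O k); rewrite ?expr1n ?expr0n.
rewrite integral0 in cvg0.
have cvgr : (fun k => nrm (mul_op \1_(O k) g) ^+ 2) @ \oo --> (0 : R).
  rewrite (_ : (fun k => _) = fine \o (fun k => (\int[leb]_x h k x)%E)).
    exact: fine_cvg.
  apply/funext => k /=.
  rewrite (L2_nrm_ae (mul_cLfun2 (mi k) (@indic_norm_le1 (O k)) g)
    (mul_opE (mi k) (@indic_norm_le1 (O k)) g)).
  by [].
have : 0 < a ^+ 2 by rewrite exprn_gt0.
move=> /(cvgr_lt (0 : R) cvgr); apply: filterS => k hk.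
apply: le_lt_trans (bound k) _.
by rewrite -(@ltr_pXn2r _ 2)// ?nnegrE ?nrm_ge0// ltW.
Qed.

End multiplication.

(** * The two inclusions *)

Section zhislin.
Context {R : realType} {d : nat}.
Local Notation leb := (@lebesgue_rV R d).
Local Notation L := (L2 leb).
Local Notation form := (L2_form leb).
Local Notation nrm := (real_nrm form).
Variable A : operator L.

Lemma enormZ (a : R) (x : 'rV[R]_d) : enorm (a *: x) = `|a| * enorm x.
Proof.
rewrite /enorm -sqrtr_sqr -sqrtrM ?sqr_ge0// mulr_sumr; congr Num.sqrt.
by apply: eq_bigr => i _; rewrite mxE exprMn.
Qed.

Lemma compact_operator_cluster (S : L -> L) (w : nat -> L) :
  compact_operator S -> (forall n, nrm (w n) <= 1) ->
  exists y, forall (e : R) j, 0 < e -> exists2 n, (j <= n)%N & nrm (S (w n) - y) <= e.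
Proof.
rewrite /compact_operator precompactE => cS w1.
pose F := (fun n => S (w n)) @ \oo.
have FK : F (closure (S @` [set u | `|u| <= 1])).
  exists 0%N => // n _; apply: subset_closure; exists (w n) => //=.
  by rewrite L2_norm_nrm lecR.
have [y [_ cy]] := cS F _ FK.
exists y => e j e0.
have e0' : 0 < e%:C%C by rewrite ltcR.
have [z [[n jn <-] hz]] := cy [set S (w n) | n in [set n | (j <= n)%N]] (ball y e%:C%C)
  (ex_intro2 _ _ j I (fun n jn => ex_intro2 _ _ n jn erefl)) (nbhsx_ballx y _ e0').
exists n => //; move: hz; rewrite -ball_normE /ball_ /= L2_norm_nrm ltcR nrmBC.
exact: ltW.
Qed.

(** Each [u n] is the resolvent at [z] of [(A - z) (u n)], and these vectors stay bounded when [lam]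
    is replaced by [z]. *)
Lemma locally_compact_cluster (B : set 'rV[R]_d) (lam : R) :
  locally_compact_operator A -> measurable B -> bounded_set B ->
  forall u : nat -> L,
  (forall n, [/\ dom A (u n), nrm (u n) <= 1 & nrm (A (u n) - lam%:C%C *: u n) <= 1]) ->
  exists y, forall j, exists2 n, (j <= n)%N & nrm (mul_op \1_B (u n) - y) <= rate j.
Proof.
move=> [_ _ lc] mB bB u hu; have [z rz cS] := lc B mB bB.
have [[c c0 hc] _] := (resolvent_setP A z).1 rz.
have inj := bounded_below_injective c0 hc.
(* [M] bounds the norm of [(A - z) (u n)], with [1] for [(A - lam) (u n)] and the rest for the
   shift, so that [w n] is in the unit ball. *)
pose M : R := 1 + complex.Re `|lam%:C%C - z|.
have M0 : 0 < M by rewrite ltr_wpDr// normc_def /= sqrtr_ge0.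
pose w n := (M^-1)%:C%C *: (A (u n) - z *: u n).
have [|y hy] := compact_operator_cluster (w := w) cS.
  move=> n; rewrite /w nrmZ gtr0_norm ?invr_gt0// ler_pdivrMl// mulr1.
  have [_ u1 Bu] := hu n.
  have -> : A (u n) - z *: u n = (A (u n) - lam%:C%C *: u n) + (lam%:C%C - z) *: u n.
    by rewrite scalerBl subrKA.
  apply: le_trans (nrmD _ _ _) _; rewrite lerD// nrmZC.
  by rewrite ler_piMr// normc_def /= sqrtr_ge0.
exists (M%:C%C *: y) => j.
have [|n jn hn] := hy (rate j / M) j; first by rewrite divr_gt0// rate_gt0.
exists n => //; have [Du _ _] := hu n.
have E : resolvent A z (w n) = (M^-1)%:C%C *: u n.
  by rewrite /w -shiftZ// resolventE//; exact: domZ.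
have mI : measurable_fun setT (\1_B : 'rV[R]_d -> R) by exact: measurable_indic.
move: hn; rewrite E (mul_opZ mI (@indic_norm_le1 _ _ B)) => hn.
have -> : mul_op \1_B (u n) - M%:C%C *: y =
    M%:C%C *: ((M^-1)%:C%C *: mul_op \1_B (u n) - y).
  by rewrite scalerBr scalerA -rmorphM /= divff ?gt_eqF// scale1r.
by rewrite nrmZ gtr0_norm// mulrC -ler_pdivlMr.
Qed.

(** The operator norm is a supremum over the unit ball, so [(A - 'i) u] is first normalised; its
    resolvent returns a multiple of [u]. *)
Lemma commutator_le (f : 'rV[R]_d -> R) (K e : R) u :
  self_adjoint L2_dot A -> measurable_fun setT f -> (forall x, `|f x| <= K) ->
  (forall u, dom A u -> dom A (mul_op f u)) ->
  (opnorm (fun u => commutator A f (resolvent A 'i u)) <= e%:E)%E ->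
  dom A u -> 0 < nrm u -> nrm (commutator A f u) <= e * nrm (A u - 'i *: u).
Proof.
move=> sa mf fK Df he Du u0.
have isa := self_adjointP sa.
have hi v : dom A v -> 1 * nrm v <= nrm (A v - 'i *: v).
  move=> Dv; have := nonreal_bounded_below isa 'i%C Dv.
  by rewrite /= normr1 complexiE.
set w := A u - 'i *: u.
have w0 : 0 < nrm w by apply: lt_le_trans u0 _; have := hi u Du; rewrite mul1r.
pose c := ((nrm w)^-1)%:C%C.
have E : resolvent A 'i (c *: w) = c *: u.
  rewrite /w -(shiftZ 'i c Du); apply: (resolventE _ (domZ c Du)).
  exact: bounded_below_injective ltr01 hi.
have com : commutator A f (c *: u) = c *: commutator A f u.
  rewrite /commutator (opZ c Du) !(mul_opZ mf fK) (opZ c (Df u Du)).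
  by rewrite scalerBr.
have cw : nrm (c *: w) <= 1.
  by rewrite /c nrmZ gtr0_norm ?invr_gt0// mulVf// gt_eqF.
have : ((complex.Re `|commutator A f (resolvent A 'i (c *: w))|)%:E <= e%:E)%E.
  apply: le_trans he; apply: ereal_sup_ubound; exists (c *: w) => //=.
  by rewrite L2_norm_nrm lecR.
rewrite E com L2_norm_nrm lee_fin /= /c nrmZ gtr0_norm ?invr_gt0//.
by rewrite ler_pdivrMl// mulrC.
Qed.

Lemma approximate_eigenvector (lam : R) :
  self_adjoint L2_dot A -> locally_compact_operator A ->
  essential_spectrum A lam%:C%C ->
  forall (B : set 'rV[R]_d) (e : R), measurable B -> bounded_set B -> 0 < e ->
  exists u, [/\ dom A u, nrm u = 1, nrm (A u - lam%:C%C *: u) < e &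
    nrm (mul_op \1_B u) < e].
Proof.
move=> sa lc [sp nd] B e mB bB e0; apply: contrapT => hno.
have isa := self_adjointP sa.
have mI : measurable_fun setT (\1_B : 'rV[R]_d -> R) by exact: measurable_indic.
have I1 := @indic_norm_le1 R d B.
have nreg : ~ regular form A lam%:C%C by move=> /resolvent_setP.
have est u : dom A u ->
    nrm u <= e^-1 * (nrm (A u - lam%:C%C *: u) + nrm (mul_op \1_B u)).
  move=> Du; have [->|un0] := eqVneq u 0.
    by rewrite nrm0 mulr_ge0 ?addr_ge0 ?nrm_ge0// invr_ge0 ltW.
  have u0 : 0 < nrm u by exact: nrm_gt0.
  pose c := ((nrm u)^-1)%:C%C.
  (* A vector violating the estimate becomes, once normalised, one of the approximate eigenvectors
     excluded by [hno]. *)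
  rewrite mulrC ler_pdivlMr// leNgt; apply/negP => hlt; apply: hno.
  have Bc : A (c *: u) - lam%:C%C *: (c *: u) = c *: (A u - lam%:C%C *: u).
    exact: shiftZ.
  have n1 := nrm_ge0 form (A u - lam%:C%C *: u).
  have n2 := nrm_ge0 form (mul_op \1_B u).
  exists (c *: u); split.
  - exact: domZ.
  - by rewrite /c nrmZ gtr0_norm ?invr_gt0// mulVf// gt_eqF.
  - rewrite Bc /c nrmZ gtr0_norm ?invr_gt0// ltr_pdivrMl//.
    by apply: le_lt_trans hlt; rewrite lerDl; exact: n2.
  - rewrite (mul_opZ mI I1) /c nrmZ gtr0_norm ?invr_gt0// ltr_pdivrMl//.
    by apply: le_lt_trans hlt; rewrite lerDr; exact: n1.
have ei : 0 < e^-1 by rewrite invr_gt0.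
have XB u v : dom A u -> dom A v -> mul_op \1_B (u - v) = mul_op \1_B u - mul_op \1_B v.
  by move=> _ _; exact: (mul_opB mI I1).
have cpt := locally_compact_cluster lc mB bB (lam := lam).
have [c c0 hc] := near_regular (@L2_complete _ _ _ leb) isa ei XB est cpt.
(* A trivial kernel would make [lam] regular, by the second case of [near_regular]. *)
have [v kv v0] : exists2 v, ker_shift A lam v & v != 0.
  apply: contrapT => h; apply: nreg; apply: hc; first by rewrite subrr normr0.
  by right => v kv; apply: contrapT => /eqP v0; apply: h; exists v.
apply: nd; split.
- by exists v.
- have [b ob hb] := ker_shift_finite ei XB est cpt.
  exists (size b), (fun j => b`_j) => u ku.
  exists (fun j => (real_ip form u b`_j)%:C%C).
  by rewrite -{1}(hb u ku) /oproj (big_nth 0) big_mkord.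
- split; first by rewrite inE.
  exists (ball (lam%:C%C : R[i]^o) c%:C%C).
    by apply: nbhsx_ballx; rewrite ltcR.
  apply/seteqP; split => [z [zc zs]|_ ->]; last first.
    by split => //; apply: ballxx; rewrite ltcR.
  (* Every [z] near [lam] other than [lam] is regular: by self-adjointness if it is not real, by
     [hc] if it is. *)
  apply: contrapT => /= zl; apply: zs; apply/resolvent_setP.
  have [zi|zi] := eqVneq (complex.Im z) 0; last first.
    exact: (nonreal_regular (@L2_complete _ _ _ leb) isa).
  have zE : z = (complex.Re z)%:C%C by case: z zi {zc zl} => a b /= ->.
  rewrite zE; apply: hc.
    move: zc; rewrite -ball_normE /ball_ /= {1}zE -rmorphB normc_def /= expr0n addr0.
    by rewrite sqrtr_sqr ltcR distrC.
  by left; apply/eqP => h; apply: zl; rewrite zE h.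
Qed.

End zhislin.

(** * Comparison of the essential and Zhislin spectra *)

Section main.
Context {R : realType} {d : nat}.
Local Notation leb := (@lebesgue_rV R d).
Local Notation L := (L2 leb).
Local Notation form := (L2_form leb).
Local Notation nrm := (real_nrm form).
Implicit Types A : operator L.

Lemma spectrum_real A z : self_adjoint L2_dot A -> spectrum A z ->
  z = (complex.Re z)%:C%C.
Proof.
move=> sa sz; have [zi|zi] := eqVneq (complex.Im z) 0.
  by case: z zi {sz} => a b /= ->.
by exfalso; apply: sz; apply/resolvent_setP; exact: (nonreal_regular (@L2_complete _ _ _ leb) (self_adjointP sa) zi).
Qed.

(** A complex spanning family spans over the reals once the multiples ['i *: b j] are added. *)
Lemma finite_multiplicity_oproj A (lam : R) : finite_multiplicity A lam%:C%C ->
  exists2 e, orthonormalR form e & forall p, ker_shift A lam p -> oproj form e p = p.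
Proof.
move=> [n [b hb]].
have [e oe he] := gram_schmidt form
  ([seq b j | j <- enum 'I_n] ++ [seq 'i%C *: b j | j <- enum 'I_n]).
exists e => // p [Dp Ap]; have [c ->] := hb p (conj Dp Ap).
elim/big_ind: _ => [|x y hx hy|j _].
- by rewrite /oproj big1// => x _; rewrite ip0l scale0r.
- by rewrite oprojD hx hy.
have -> : c j *: b j = (complex.Re (c j))%:C%C *: b j +
    (complex.Im (c j))%:C%C *: ('i%C *: b j).
  by rewrite scalerA -scalerDl {1}[c j]complexE [_ * 'i%C]mulrC.
have h1 : oproj form e (b j) = b j.
  by apply: he; rewrite mem_cat map_f ?mem_enum.
have h2 : oproj form e ('i%C *: b j) = 'i%C *: b j.
  by apply: he; rewrite mem_cat (map_f (fun j => 'i%C *: b j)) ?mem_enum ?orbT.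
by rewrite oprojD !oprojZ h1 h2.
Qed.

Lemma zhislin_essential A : self_adjoint L2_dot A ->
  zhislin_spectrum A `<=` essential_spectrum A.
Proof.
move=> sa z [u [hu cu]].
have u1 k : nrm (u k) = 1.
  by have [_ + _] := hu k; rewrite L2_norm_nrm => /complexI.
have Bu (a : R) : 0 < a -> \forall n \near \oo, nrm (A (u n) - z *: u n) < a.
  move=> a0; have a0' : 0 < a%:C%C by rewrite ltcR.
  move/cvgrPdist_lt : cu => /(_ _ a0'); apply: filterS => n.
  by rewrite sub0r normrN L2_norm_nrm ltcR.
have sz : spectrum A z.
  move=> /resolvent_setP[[c c0 hc] _].
  have [N _ hN] := Bu c c0.
  have [Du _ _] := hu N.
  by have := hc _ Du; rewrite u1 mulr1 leNgt hN //=.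
have zE := spectrum_real sa sz; split => // -[_ fm [_ [V Vz VE]]].
rewrite zE in fm Bu.
have [e oe he] := finite_multiplicity_oproj fm.
(* A positive radius in [R[i]] is real, so the isolating neighbourhood contains a real interval
   around [complex.Re z]. *)
have [r r0 hr] : exists2 r : R, 0 < r & forall t : R, `|t - complex.Re z| < r ->
    V (t%:C%C : R[i]^o).
  move: Vz => /nbhs_ballP[[r ri] /= r0 rV].
  have ri0 : ri = 0 by move: r0; rewrite ltcE /= => /andP[/eqP ->].
  exists r; first by move: r0; rewrite ri0 ltcR.
  move=> t ht; apply: rV; rewrite -ball_normE /ball_ /= {1}zE ri0 -rmorphB.
  by rewrite normc_def /= expr0n addr0 sqrtr_sqr ltcR distrC.
apply: (no_singular_sequence (@L2_complete _ _ _ leb) (self_adjointP sa) (d := r / 2) oe he _ _ (u := u) _ Bu).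
- by rewrite divr_gt0.
- move=> t /andP[t0 tr]; apply/resolvent_setP; apply: contrapT => tn.
  have : (V `&` spectrum A) (t%:C%C : R[i]^o).
    by split => //; apply: hr; lra.
  rewrite VE /= => tz; move: t0; have -> : t = complex.Re z by rewrite -tz.
  by rewrite subrr normr0 ltxx.
- by move=> n; split; [have [] := hu n|].
- apply: escaping_weakly_null => // k.
  by have [_ _ h] := hu k; exact: ess_supp_ae.
Qed.

Lemma essential_zhislin A (phi : 'rV[R]_d -> R) :
  self_adjoint L2_dot A ->
  locally_compact_operator A ->
  C0_infty phi -> supp phi `<=` eball 0 2 -> (forall x, eball 0 1 x -> phi x = 1) ->
  (forall k : nat, (1 <= k)%N ->
     forall u, dom A u -> dom A (mul_op (dilate phi k) u)) ->
  opnorm (fun u => commutator A (dilate phi k) (resolvent A 'i u))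
    @[k --> \oo] --> 0%E ->
  essential_spectrum A `<=` zhislin_spectrum A.
Proof.
move=> sa lc [smooth_phi csupp] supp2 phi1 Dphi op0 z ez.
have zE := spectrum_real sa ez.1; set lam := complex.Re z in zE.
have cphi : continuous phi by have [+ _] := smooth_phi [::].
have [M M0 phiM] : exists2 M : R, 0 <= M & forall x, `|phi x| <= M.
  have := compact_bounded (continuous_compact (continuous_subspaceT cphi) csupp).
  move=> [M [_ hM]]; exists (`|M| + 1); first by rewrite addr_ge0.
  move=> x; have [->|px] := eqVneq (phi x) 0; first by rewrite normr0 addr_ge0.
  apply: hM; first by rewrite (le_lt_trans (ler_norm M))// ltrDl.
  by exists x => //; apply: subset_closure.
have phi_out x : 2 <= enorm x -> phi x = 0.
  move=> x2; apply: contrapT => /eqP px.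
  have : eball 0 2 x by apply: supp2; apply: subset_closure.
  by rewrite /eball /= subr0 ltNge x2.
(* The shift by one avoids the dilation by [0] and makes [f k] equal to [1] on the open ball of
   radius [k + 1], which contains the closed ball of radius [k]. *)
pose f k := dilate phi k.+1; pose K k : R := k.+1%:R.
have K0 k : 0 < K k by rewrite ltr0n.
have fM k x : `|f k x| <= M by exact: phiM.
have mf k : measurable_fun setT (f k).
  apply: continuous_measurable_rV => x; apply: continuous_comp; last exact: cphi.
  exact: scaler_continuous.
have f_out k x : ~ [set y : 'rV[R]_d | enorm y <= 2 * K k] x -> f k x = 0.
  move=> /= /negP; rewrite -ltNge => hx; apply: phi_out; rewrite enormZ.
  by rewrite gtr0_norm ?invr_gt0// ler_pdivlMl// mulrC ltW.
have f_in k x : enorm x < K k -> f k x = 1.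
  move=> hx; apply: phi1; rewrite /eball /= subr0 enormZ.
  by rewrite gtr0_norm ?invr_gt0// ltr_pdivrMl// mulr1.
(* [q] bounds the norm of [(A - 'i) u] for a unit vector [u] with [(A - lam) u] of norm at most
   [1]. *)
pose q : R := 1 + complex.Re `|lam%:C%C - 'i : R[i]|.
have q0 : 0 < q by rewrite ltr_wpDr// normc_def /= sqrtr_ge0.
(* The estimate holds for every bound [e] on the commutator, so that [w] is chosen before the
   tolerance. *)
have step k : exists w : L, [/\ dom A w, nrm w = 1,
    ess_supp w `<=` ~` [set x | enorm x <= k%:R] &
    forall e : R, (opnorm (fun u => commutator A (f k) (resolvent A 'i u)) <= e%:E)%E ->
      nrm (A w - lam%:C%C *: w) <= 2 * (rate k + e * q)].
  (* This [a] gives both [(1 + M) * a <= rate k] and [M * a <= 1/2]; the second makes the norm of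
     [mul_op (f k) u] at most [1/2], hence that of [v] at least [1/2]. *)
  pose a : R := rate k / (2 * (1 + M)).
  have M1 : 0 < 1 + M by rewrite ltr_wpDr.
  have rk := @rate_gt0 R k; have rk1 := @rate_le1 R k.
  have aE : a * (2 * (1 + M)) = rate k by rewrite /a divfK// gt_eqF// mulr_gt0.
  have a0 : 0 < a by rewrite divr_gt0// mulr_gt0.
  pose B := [set y : 'rV[R]_d | enorm y <= 2 * K k].
  have mB : measurable B by exact: measurable_enorm_le.
  have bB : bounded_set B by apply: compact_bounded; exact: compact_enorm_le.
  have ez' : essential_spectrum A lam%:C%C by rewrite -zE.
  have [u [Du u1 Bu Xu]] := approximate_eigenvector sa lc ez' mB bB a0.
  have fu : nrm (mul_op (f k) u) <= 2^-1.
    apply: le_trans (nrm_mul_op_indic u (mf k) (fM k) mB (f_out k)) _.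
    apply: le_trans (ler_wpM2l M0 (ltW Xu)) _.
    by move: M0 a0 aE rk1; clear; move: a (rate k) => x r; nra.
  have Dfu : dom A (mul_op (f k) u) by exact: Dphi.
  pose v : L := u - mul_op (f k) u.
  have Dv : dom A v by exact: domB.
  have v2 : 2^-1 <= nrm v.
    have : nrm u <= nrm v + nrm (mul_op (f k) u).
      by rewrite -{1}[u](subrK (mul_op (f k) u)) nrmD.
    rewrite u1 => /le_trans/(_ (lerD (lexx _) fu)); rewrite -lerBlDr.
    by apply: le_trans; clear; lra.
  have v0 : 0 < nrm v by apply: lt_le_trans v2; rewrite invr_gt0.
  pose c := ((nrm v)^-1)%:C%C.
  have nc x : nrm (c *: x) = (nrm v)^-1 * nrm x by rewrite /c nrmZ gtr0_norm ?invr_gt0.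
  exists (c *: v); split.
  - exact: domZ.
  - by rewrite nc mulVf// gt_eqF.
  - apply: (@ae_ess_supp _ _ _ _ (K k)); first by rewrite ltr_nat.
    have hv : \forall x \ae leb, v x = (u : L) x - mul_op (f k) u x.
      exact: L2_funB.
    apply: filterS3 (L2_funZ c v) hv (mul_opE (mf k) (fM k) u) => x -> -> -> xk.
    by rewrite f_in// mul1r subrr mulr0.
  - move=> e he.
    have hcom := commutator_le sa (mf k) (fM k) (Dphi k.+1 isT) he Du.
    rewrite (shiftZ lam%:C%C c Dv) nc ler_pdivrMl//.
    have -> : A v - lam%:C%C *: v = (A u - lam%:C%C *: u) -
        mul_op (f k) (A u - lam%:C%C *: u) - commutator A (f k) u.
      rewrite /v (shiftB lam%:C%C Du Dfu) /commutator.
      rewrite (mul_opB (mf k) (fM k)) (mul_opZ (mf k) (fM k)).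
      rewrite -[RHS]addrA -opprD; congr (_ - _).
      by rewrite [RHS]addrC subrKA.
    have e0 : 0 <= e.
      rewrite -lee_fin; apply: le_trans he.
      apply: (@le_trans _ _
        (complex.Re `|commutator A (f k) (resolvent A 'i 0)|)%:E).
        by rewrite lee_fin L2_norm_nrm nrm_ge0.
      by apply: ereal_sup_ubound; exists 0 => //=; rewrite normr0 ler01.
    have h1 := nrmB form (A u - lam%:C%C *: u - mul_op (f k) (A u - lam%:C%C *: u))
      (commutator A (f k) u).
    have h2 := nrmB form (A u - lam%:C%C *: u) (mul_op (f k) (A u - lam%:C%C *: u)).
    have h3 := nrm_mul_op (mf k) (fM k) (A u - lam%:C%C *: u).
    have h4 : nrm (A u - 'i *: u) <= q.
      have -> : A u - 'i *: u = (A u - lam%:C%C *: u) + (lam%:C%C - 'i) *: u.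
        by rewrite scalerBl subrKA.
      apply: le_trans (nrmD _ _ _) _; rewrite nrmZC u1 mulr1 lerD2r.
      apply: ltW; apply: lt_le_trans Bu _.
      move: M1 aE a0 M0 rk1; clear; move: (rate k) => r; nra.
    have h5 := hcom ltac:(by rewrite u1).
    have h6 : nrm (commutator A (f k) u) <= e * q.
      by apply: le_trans h5 _; rewrite ler_wpM2l.
    have h7 : nrm (A u - lam%:C%C *: u) + M * nrm (A u - lam%:C%C *: u) <= rate k.
      rewrite -[X in X + _]mul1r -mulrDl.
      apply: le_trans (ler_wpM2l (ltW M1) (ltW Bu)) _.
      have : 0 <= (1 + M) * a by rewrite mulr_ge0// ltW.
      by move: aE; clear; move: a (rate k) => x r; nra.
    have h8 := le_trans (le_trans h2 (lerD (lexx _) h3)) h7.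
    apply: le_trans h1 _; apply: le_trans (lerD h8 h6) _.
    have p : 0 <= rate k + e * q by rewrite addr_ge0 ?mulr_ge0// ltW.
    (* Normalising by the norm of [v], at least [1/2], accounts for the factor [2]. *)
    rewrite mulrA ler_peMl//; move: v2; clear; move: (nrm v) => n; lra.
have /choice[w hw] := step; exists w; split.
  move=> k; have [Dw w1 sw _] := hw k; split => //.
  by rewrite L2_norm_nrm w1.
apply/cvgrPdist_le => e0 e0_gt0.
have [e e_gt0 ->] : exists2 e : R, 0 < e & e0 = e%:C%C.
  case: e0 e0_gt0 => a b; rewrite ltcE /= => /andP[/eqP -> a0]; by exists a.
(* With this [b], the bound [2 * (rate k + b * q)] is at most [e] once [rate k < e / 4]. *)
pose b := e / (4 * q).
have b0 : 0 < b by rewrite divr_gt0// mulr_gt0.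
have hop : \forall k \near \oo,
    (opnorm (fun u => commutator A (f k) (resolvent A 'i u)) <= b%:E)%E.
  have nb : nbhs (0%E : \bar R) [set y | (y < b%:E)%E].
    by apply: open_nbhs_nbhs; split; [exact: open_ereal_lt_ereal|rewrite /= lte_fin].
  have [N _ hN] := op0 _ nb.
  by exists N => [|k Nk]; [exact: I|exact: (ltW (hN k.+1 (leqW Nk)))].
have [N hN] := rate_lt (divr_gt0 e_gt0 (ltr0Sn R 3)).
have hr : \forall k \near \oo, rate k < e / 4 by exists N.
apply: filterS2 hop hr => k hop hr.
rewrite sub0r normrN L2_norm_nrm lecR zE.
have [_ _ _ /(_ _ hop) h] := hw k; apply: le_trans h _.
have bq : b * q = e / 4 by rewrite /b invfM mulrA divfK ?gt_eqF.
by rewrite bq; move: hr; clear; move: (rate k) => r; lra.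
Qed.


End main.

Theorem theorem4 (R : realType) (d : nat)
    (A : operator (L2 (@lebesgue_rV R d))) :
  self_adjoint L2_dot A ->
  locally_compact_operator A ->
  (exists phi : 'rV[R]_d -> R,
    [/\ C0_infty phi, supp phi `<=` eball 0 2,
        (forall x, 0 <= phi x) & (forall x, eball 0 1 x -> phi x = 1)] /\
    (forall k : nat, (1 <= k)%N ->
       forall u, dom A u -> dom A (mul_op (dilate phi k) u)) /\
    opnorm (fun u => commutator A (dilate phi k) (resolvent A 'i u))
      @[k --> \oo] --> 0%E) ->
  essential_spectrum A = zhislin_spectrum A.
Proof.
move=> sa lc [phi [[sphi supp2 _ phi1] [Dphi op0]]].
apply/seteqP; split.
  exact: essential_zhislin sa lc sphi supp2 phi1 Dphi op0.
exact: zhislin_essential.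
Qed.
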